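(* For each integer $k\ge 2$ and each $\alpha>0$ there is some $\eta>0$ such that the following holds: if, for each $n$, $G_\alpha$ is a graph on vertex set $[n]$ with minimum degree at least $\alpha n$, then with high probability $G_\alpha\cup G(n,n^{-1/k-\eta})$ contains the $k$th power of a Hamilton cycle.
   Context: $G(n,p)$ denotes the binomial random graph on vertex set $[n]$ in which each pair is an edge independently with probability $p$; $G_\alpha\cup G(n,p)$ is the graph on $[n]$ whose edge set is the union of the two edge sets. ''With high probability'' means with probability tending to $1$ as $n\to\infty$. The $k$th power of a graph $H$ is the graph on $V(H)$ in which two vertices are adjacent iff their distance in $H$ is at most $k$; the $k$th power of a Hamilton cycle is the $k$th power of a cycle on all $n$ vertices (as a subgraph). *)

(* Defs.v *)
From HB Require Import structures.
From mathcomp Require Import all_boot all_order all_algebra.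
From mathcomp Require Import all_classical all_reals all_analysis.
Set Implicit Arguments.
Unset Strict Implicit.
Unset Printing Implicit Defensive.
Import Order.TTheory GRing.Theory Num.Theory.
Import numFieldNormedType.Exports.
Local Open Scope ring_scope.

(* A simple graph on the vertex set T is represented by its edge set
   E : {set {set T}}, all of whose members are 2-element sets. *)

Definition pairs (T : finType) : {set {set T}} := [set e : {set T} | (#|e| == 2)%N].

Definition simple_graph (T : finType) (E : {set {set T}}) : bool :=
  E \subset pairs T.

Definition adj (T : finType) (E : {set {set T}}) : rel T :=
  [rel x y | [set x; y] \in E].

Definition degree (T : finType) (E : {set {set T}}) (v : T) : nat :=
  #|[set u | adj E v u]|.

(* The product measure: each pair is an edge independently with probability p. *)
Definition gnp_weight (R : realType) (T : finType) (p : R)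
    (E : {set {set T}}) : R :=
  \prod_(e in pairs T) (if e \in E then p else 1 - p).

Definition gnp_prob (R : realType) (T : finType) (p : R)
    (A : pred {set {set T}}) : R :=
  \sum_(E : {set {set T}} | simple_graph E && A E) gnp_weight p E.

Definition walk (T : finType) (H : rel T) (x y : T) (d : nat) : bool :=
  [exists p : d.-tuple T, path H x p && (last x p == y)].

(* The least d < #|T| such that a walk of length d joins x to y; it is the
   junk value #|T| when x and y lie in different components. *)
Definition gdist (T : finType) (H : rel T) (x y : T) : nat :=
  find (walk H x y) (iota 0 #|T|).

Definition graph_power (T : finType) (k : nat) (H : rel T) : rel T :=
  [rel x y | [&& x != y, connect H x y & (gdist H x y <= k)%N]].

Definition cycle_graph (T : finType) (c : seq T) : rel T :=
  [rel x y | [&& x \in c, y \in c & (next c x == y) || (next c y == x)]].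

(* c lists every vertex exactly once. *)
Definition hamilton_cycle (T : finType) (c : seq T) : bool :=
  [&& uniq c, size c == #|T| & (2 < #|T|)%N].

Definition has_hamilton_power (T : finType) (k : nat) (E : {set {set T}}) : bool :=
  [exists c : #|T|.-tuple T, hamilton_cycle c &&
    [forall x, forall y, graph_power k (cycle_graph c) x y ==> adj E x y]].

(* Main.v *)
Require Import Defs.
From HB Require Import structures.
From mathcomp Require Import all_boot all_order all_algebra all_fingroup.
From mathcomp Require Import all_classical all_reals all_analysis.
From mathcomp Require Import finset zify ring lra.
Set Implicit Arguments.
Unset Strict Implicit.
Unset Printing Implicit Defensive.
Import Order.TTheory GRing.Theory Num.Theory.
Import numFieldNormedType.Exports.
Local Open Scope ring_scope.

(* Let S(t) be the set of edges of the k-th power of the Hamilton cycle given by an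
   ordering t of the vertices which do not lie in G.  It suffices to find a probability
   distribution on orderings for which S(t) is q-spread, i.e. contains any fixed set A
   with probability at most q^|A|, for some q = C n^(-1/k - 4 eta).  Indeed, expose the
   random graph in boundedly many rounds of density n^(2 eta) q: in each round the
   Park-Pham minimal fragment argument shrinks the part of (a typical) S(t) still missing
   by a factor n^eta, until nothing is missing.

   The ordering is obtained by placing a G-edge on the positions jL, jL+1 for all j, the
   ends being chosen one after the other uniformly among the vertices, respectively
   among the unused G-neighbours of the previous vertex (there are linearly many of
   them), and the other vertices uniformly at random.  Then any v vertices
   are in prescribed positions with probability at most (C/n)^v, and a graph A with
   v - c = |V(A)| minus number of components lies in the cycle power with probability
   at most (C/n)^(v - c).  As the planted edges are missing from S(t), a set A that is
   contained in some S(t) has at most (k - eps)(v - c) edges, with eps = eps(k, L). *)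

(** * Sparsity of subgraphs of a power of a path *)

Lemma adj_sym (T : finType) (E : {set {set T}}) : symmetric (adj E).
Proof. by move=> x y; rewrite /adj /= finset.setUC. Qed.

Lemma adj_connect_sym (T : finType) (E : {set {set T}}) :
  connect_sym (adj E).
Proof. exact/sym_connect_sym/adj_sym. Qed.

Section LinearOrder.
Local Open Scope nat_scope.
Variables (T : finType) (A : {set {set T}}) (pos : T -> nat) (k w : nat).
Hypothesis posI : injective pos.
Hypothesis Apairs : A \subset pairs T.

(** The vertices other than the leftmost one of their component; their number is that of vertices
    minus that of components, the exponent in the probability bounds. *)
Definition late : {set T} :=
  [set x | [exists y, connect (adj A) x y && (pos y < pos x)]].

Definition left_nbrs x : {set T} := [set y | adj A x y && (pos y < pos x)].

Hypothesis k_ge2 : 2 <= k.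
Hypothesis adj_near : forall x y, adj A x y -> pos y <= pos x + k.
(** Any [w.+1] consecutive positions contain two neighbouring ones not joined in [A]; later these
    carry a planted edge. *)
Hypothesis window : forall x,
  (forall i, i <= w -> exists y, pos y + i = pos x) ->
  exists y z, [/\ pos z = (pos y).+1, pos x <= pos y + w, pos z <= pos x
                & ~~ adj A z y].

Let left_uniq x : uniq [seq pos y | y <- enum (left_nbrs x)].
Proof. by rewrite map_inj_uniq // enum_uniq. Qed.

Let left_sub x : {subset [seq pos y | y <- enum (left_nbrs x)]
  <= iota (pos x - k) (pos x - (pos x - k))}.
Proof.
move=> i /mapP[y]; rewrite mem_enum inE => /andP[axy lt_yx] ->.
rewrite adj_sym in axy; have := adj_near axy.
by rewrite mem_iota; lia.
Qed.

Lemma card_left_nbrs x : #|left_nbrs x| <= k.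
Proof.
have := uniq_leq_size (left_uniq x) (@left_sub x).
by rewrite size_map size_iota -cardE; lia.
Qed.

(** Left neighbours occupy distinct positions among the [k] preceding ones, so [k] of them fill all
    these positions. *)
Lemma left_nbrs_full x j : k <= #|left_nbrs x| -> 0 < j <= k ->
  exists2 y, adj A x y & pos y + j = pos x.
Proof.
move=> full /andP[j_gt0 j_le].
have sz : size (iota (pos x - k) (pos x - (pos x - k)))
    <= size [seq pos y | y <- enum (left_nbrs x)].
  by rewrite size_map size_iota -cardE; apply: leq_trans full; lia.
have [] := uniq_min_size (left_uniq x) (@left_sub x) sz.
rewrite size_map size_iota -cardE => eqsz eqm.
have : pos x - j \in iota (pos x - k) (pos x - (pos x - k)).
  by rewrite mem_iota; lia.
rewrite -eqm => /mapP[y]; rewrite mem_enum inE => /andP[axy _] eqp.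
by exists y => //; lia.
Qed.

(* A run of consecutive vertices with full left neighbourhoods stays inside one
   component, so it reaches back to the missing edge provided by [window]. *)
Lemma late_deficient x : x \in late -> exists y,
  [/\ y \in late, #|left_nbrs y| < k, pos y <= pos x & pos x <= pos y + w].
Proof.
move=> x_late.
case: (boolP [exists y, [&& y \in late, #|left_nbrs y| < k, pos y <= pos x
                          & pos x <= pos y + w]]).
  by case/existsP=> y /and4P[? ? ? ?]; exists y.
rewrite negb_exists => /forallP none.
have full y : y \in late -> pos y <= pos x -> pos x <= pos y + w ->
    k <= #|left_nbrs y|.
  move=> yl le1 le2; rewrite leqNgt; apply: contra (none y) => lt.
  by rewrite yl lt le1.
have run i : i <= w -> exists2 y, y \in late & pos y + i = pos x.
  elim: i => [|i IH] lei; first by exists x; rewrite // addn0.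
  have [y yl yx] := IH (ltnW lei).
  have fy : k <= #|left_nbrs y| by apply: full => //; lia.
  (* As [k >= 2], there are neighbours one and two steps back; the second lies to the left of the
     first in the same component, so the first is late again. *)
  have [z1 az1 pz1] := left_nbrs_full (j := 1) fy (ltnW k_ge2).
  have [z2 az2 pz2] := left_nbrs_full (j := 2) fy k_ge2.
  exists z1; last by lia.
  rewrite inE; apply/existsP; exists z2; apply/andP; split; last by lia.
  apply: connect_trans (connect1 az2).
  by rewrite adj_connect_sym connect1.
have [i lei|y [z [pzy le1 le2]]] := window (x := x).
  by have [y _ <-] := run i lei; exists y.
have [|z' z'l pz'] := run (pos x - pos z); first by lia.
have ? : z' = z by apply: posI; lia.
subst z'.
have fz : k <= #|left_nbrs z| by apply: full => //; lia.
have [y' az py'] := left_nbrs_full (j := 1) fz (ltnW k_ge2).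
have -> : y = y' by apply: posI; lia.
by rewrite az.
Qed.

(** Each edge is counted at its right end. A late vertex has at most [k] left neighbours, a
    deficient one at most [k - 1], and each deficient vertex serves at most [w.+1] late ones. *)
Lemma card_edges_late : #|A| * w.+1 + #|late| <= k * w.+1 * #|late|.
Proof.
pose D := [set y in late | #|left_nbrs y| < k].
have le_late : #|late| <= w.+1 * #|D|.
  have le_sum : #|late| <= \sum_(y in D) #|[set x | (pos y <= pos x) && (pos x <= pos y + w)]|.
    apply: leq_trans (_ : #|\bigcup_(y in D)
        [set x | (pos y <= pos x) && (pos x <= pos y + w)]| <= _).
      apply: subset_leq_card; apply/fintype.subsetP => x /late_deficient[y [yl yd le1 le2]].
      by apply/finset.bigcupP; exists y; rewrite inE ?yl ?yd ?le1 ?le2.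
    elim/big_rec2: _ => [|y S n _ leS]; first by rewrite finset.cards0.
    by apply: leq_trans (leq_card_setU _ _) _; rewrite leq_add2l.
  apply: leq_trans le_sum _; rewrite mulnC -sum_nat_const; apply: leq_sum => y _.
  have -> : w.+1 = size (iota (pos y) w.+1) by rewrite size_iota.
  rewrite cardE -(size_map pos); apply: uniq_leq_size.
    by rewrite map_inj_uniq // enum_uniq.
  move=> i /mapP[x]; rewrite mem_enum inE => /andP[? ?] ->.
  by rewrite mem_iota; lia.
have le_A : #|A| <= \sum_(x in late) #|left_nbrs x|.
  pose PP := [set p : T * T | p.2 \in left_nbrs p.1].
  have PPE : #|PP| = \sum_(x in late) #|left_nbrs x|.
    rewrite -sum1_card.
    rewrite (eq_bigl (fun p : T * T => true && (p.2 \in left_nbrs p.1))); last first.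
      by move=> p; rewrite inE.
    rewrite -(pair_big_dep xpredT (fun x y => y \in left_nbrs x) (fun _ _ => 1)) /=.
    rewrite (bigID (mem late)) /= [X in _ + X]big1 ?addn0.
      by apply: eq_bigr => x _; rewrite sum1_card.
    move=> x; rewrite inE => xl; apply: big1 => y; rewrite inE => /andP[axy lt].
    by case/negP: xl; apply/existsP; exists y; rewrite connect1.
  rewrite -PPE; apply: leq_trans (leq_imset_card (fun p : T * T => [set p.1; p.2]) _).
  apply: subset_leq_card; apply/fintype.subsetP => e eA.
  have := fintype.subsetP Apairs _ eA; rewrite inE => /cards2P[x [y [neq_xy ee]]].
  have axy : adj A x y by rewrite /adj /= -ee.
  have [lt|lt|eqp] := ltngtP (pos x) (pos y).
  - apply/finset.imsetP; exists (y, x); rewrite ?inE /= ?lt; first by rewrite adj_sym axy.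
    by rewrite ee finset.setUC.
  - by apply/finset.imsetP; exists (x, y); rewrite ?inE /= ?lt ?axy.
  - by rewrite (posI eqp) eqxx in neq_xy.
have le_sumD : \sum_(x in late) #|left_nbrs x| + #|D| <= k * #|late|.
  have -> : #|D| = \sum_(x in late) (#|left_nbrs x| < k).
    rewrite -sum1_card big_mkcond [RHS]big_mkcond /=; apply: eq_bigr => x _.
    by rewrite inE; case: (x \in late); case: (_ < k).
  rewrite -big_split /= mulnC -sum_nat_const; apply: leq_sum => x _.
  by have := card_left_nbrs x; case: ltnP => /=; lia.
nia.
Qed.

End LinearOrder.

(** * Random sets and minimal fragments *)

Section SumLemmas.
Variable R : realFieldType.

Lemma ler_sum_pred (I : finType) (P Q : pred I) (F : I -> R) :
  (forall i, P i -> Q i) -> (forall i, Q i -> 0 <= F i) ->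
  \sum_(i | P i) F i <= \sum_(i | Q i) F i.
Proof.
move=> PQ F0; rewrite big_mkcond [leRHS]big_mkcond /=; apply: ler_sum => i _.
case: ifP => [/PQ -> //|_]; case: ifP => // /F0 //.
Qed.

Lemma ler_sum_inj (I J : finType) (P : pred I) (Q : pred J) (u : I -> J)
    (F : I -> R) (G : J -> R) :
  {in P &, injective u} -> (forall i, P i -> Q (u i)) ->
  (forall i, P i -> F i <= G (u i)) -> (forall j, Q j -> 0 <= G j) ->
  \sum_(i | P i) F i <= \sum_(j | Q j) G j.
Proof.
move=> uI PQ FG G0.
apply: (@le_trans _ _ (\sum_(i | P i) G (u i))); first exact: ler_sum.
rewrite -(big_imset (h := u) (A := P) G) /=; last by [].
apply: ler_sum_pred => // j /imsetP[i Pi ->]; exact: PQ.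
Qed.

End SumLemmas.

Section ProductMeasure.
Variables (R : realFieldType) (X : finType).
Implicit Types (a b : X -> R) (E W T : {set X}).

(** The law of a random set containing each [e] independently with probability [a e]. The dependence
    on [e] lets non-pairs have probability 0. *)
Definition product_weight a E : R := \prod_e (if e \in E then a e else 1 - a e).

Definition union_prob a b : X -> R := fun e => a e + b e - a e * b e.

Definition prob_fun a := forall e, 0 <= a e <= 1.

Lemma product_weight_ge0 a E : prob_fun a -> 0 <= product_weight a E.
Proof.
move=> pa; apply: prodr_ge0 => e _; have /andP[a0 a1] := pa e.
by case: ifP => // _; rewrite subr_ge0.
Qed.

Lemma sum_product_weight a : \sum_E product_weight a E = 1.
Proof.
rewrite /product_weight -bigA_distr; apply: big1 => e _. by rewrite /= addrC subrK.
Qed.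

Lemma prob_fun_union_prob a b : prob_fun a -> prob_fun b -> prob_fun (union_prob a b).
Proof.
move=> pa pb e; have /andP[a0 a1] := pa e; have /andP[b0 b1] := pb e.
by rewrite /union_prob; nra.
Qed.

Lemma sum_pairs_prod (h : X -> bool -> bool -> R) :
  \sum_(W : {set X}) \sum_(E : {set X}) \prod_e h e (e \in W) (e \in E) =
  \prod_e (h e true true + h e true false + (h e false true + h e false false)).
Proof.
rewrite bigA_distr; apply: eq_bigr => W _.
rewrite (eq_bigr (fun e => h e (e \in W) true + h e (e \in W) false)); last first.
  by move=> e _; case: (e \in W).
rewrite bigA_distr; apply: eq_bigr => E _; apply: eq_bigr => e _.
by case: (e \in E).
Qed.

Lemma product_weight_setU a b W :
  \sum_W1 \sum_(W2 : {set X} | W1 :|: W2 == W) 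
      product_weight a W1 * product_weight b W2 = product_weight (union_prob a b) W.
Proof.
(* The condition [W1 :|: W2 == W] is a product of conditions at single elements, so the double sum
   factors. *)
pose h e (b1 b2 : bool) := (if b1 then a e else 1 - a e) * (if b2 then b e else 1 - b e)
                  * ((b1 || b2) == (e \in W))%:R.
rewrite (_ : product_weight _ _ = \prod_e (h e true true + h e true false
                             + (h e false true + h e false false))); last first.
  apply: eq_bigr => e _; rewrite /h /union_prob /=; case: (e \in W); rewrite /= ?mulr1 ?mulr0; ring.
rewrite -sum_pairs_prod; apply: eq_bigr => W1 _.
rewrite big_mkcond; apply: eq_bigr => W2 _.
rewrite /h /product_weight !big_split /=; case: eqP => [WE|WE].
  by rewrite [X in _ = _ * X]big1 ?mulr1 // => e _; rewrite -WE inE eqxx.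
have [e neq] : exists e, ((e \in W1) || (e \in W2)) != (e \in W).
  apply/existsP; rewrite -negb_forall; apply/negP => /forallP eqW.
  by case: WE; apply/setP => e; rewrite inE; apply/eqP.
rewrite [X in _ = _ * X](bigD1 e) //=. by rewrite (negbTE neq) mul0r mulr0.
Qed.

Lemma sum_product_weight_setU a b (f : {set X} -> R) :
  \sum_W product_weight (union_prob a b) W * f W =
  \sum_W1 product_weight a W1 * \sum_W2 product_weight b W2 * f (W1 :|: W2).
Proof.
under [LHS]eq_bigr do rewrite -product_weight_setU mulr_suml.
rewrite exchange_big /=; apply: eq_bigr => W1 _; rewrite mulr_sumr.
under eq_bigr do rewrite mulr_suml.
rewrite (exchange_big_dep xpredT) //=; apply: eq_bigr => W2 _.
rewrite (big_pred1 (W1 :|: W2)) ?mulrA // => W; rewrite eq_sym.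
Qed.

Lemma sum_subsets_exp (H : {set X}) (x : R) :
  \sum_(T : {set X} | T \subset H) x ^+ #|T| = (1 + x) ^+ #|H|.
Proof.
rewrite addrC -[RHS]prodr_const [RHS]big_mkcond /=.
rewrite [RHS](eq_bigr (fun e => (if e \in H then x else 0) + 1)); last first.
  by move=> e _; case: ifP; rewrite ?add0r.
rewrite bigA_distr [LHS]big_mkcond /=; apply: eq_bigr => T _; case: ifPn => [TH|TH].
  rewrite -prodr_const big_mkcond; apply: eq_bigr => e _.
  by case: ifP => // eT; rewrite (fintype.subsetP TH).
have [e eT eH] := subsetPn TH.
by rewrite (bigD1 e) //= eT (negbTE eH) mul0r.
Qed.

End ProductMeasure.

Section Fragments.
Variables (R : realFieldType) (X Om : finType) (P : pred Om) (S : Om -> {set X}).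
Variable mu : Om -> R.

(** The mass of [P] may be less than 1, since each round discards part of the family. *)
Definition spread (q : R) := forall A : {set X},
  \sum_(w | P w && (A \subset S w)) mu w <= q ^+ #|A|.

(** Once [W] is exposed, [w] may be replaced by any member inside [W :|: S w]; the fragment is the
    missing part of a cheapest replacement. *)
Definition frag (W : {set X}) (w : Om) : {set X} :=
  S [arg min_(v < w | P v && (S v \subset W :|: S w)) #|S v :\: W| ] :\: W.

(** The properties of a fragment that do not mention [w]; they confine [T] to any member contained
    in [W :|: T]. *)
Definition minimal_frag (W T : {set X}) :=
  [&& W :&: T == finset.set0, [exists v, P v && (S v \subset W :|: T)]
    & [forall v, P v && (S v \subset W :|: T) ==> (T \subset S v)]].

(** A member inside [W :|: frag W w] is itself a candidate replacement, and its part outside [W]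
    lies in the fragment; by minimality of the cardinality the two are equal. *)
Lemma fragP W w : P w -> [/\ minimal_frag W (frag W w), frag W w \subset S w
  & exists2 v, P v & S v \subset W :|: frag W w].
Proof.
move=> Pw; rewrite /frag; case: arg_minnP => [|v /andP[Pv Sv] vmin].
  by rewrite Pw finset.subsetUr.
have sub1 : S v \subset W :|: (S v :\: W).
  by apply/fintype.subsetP => x xv; rewrite !inE xv; case: (x \in W).
have sub2 : S v :\: W \subset S w.
  by rewrite finset.subDset.
split=> //; last by exists v.
apply/and3P; split.
- by apply/eqP/setP => x; rewrite !inE; case: (x \in W).
- by apply/existsP; exists v; rewrite Pv.
- apply/forallP => u; apply/implyP => /andP[Pu Su].
  have le : (#|S v :\: W| <= #|S u :\: W|)%N.
    apply: vmin; rewrite Pu /=; apply: fintype.subset_trans Su _.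
    by apply: finset.setUS.
  have sub : S u :\: W \subset S v :\: W.
    by rewrite finset.subDset.
  have /eqP <- : S u :\: W == S v :\: W by rewrite eqEcard sub.
  exact: finset.subsetDl.
Qed.

Hypothesis mu_ge0 : forall w, 0 <= mu w.
Variables (a : X -> R) (p q x : R) (l g : nat).
Hypothesis pa : prob_fun a.
Hypothesis aS : forall w e, P w -> e \in S w -> a e = p.
Hypothesis leS : forall w, P w -> (#|S w| <= l)%N.
Hypothesis spr : spread q.
Hypotheses (p_gt0 : 0 < p) (p_le1 : p <= 1) (q_ge0 : 0 <= q) (x_ge1 : 1 <= x).

(* [Z = W :|: T] determines the minimal fragment [T] up to the choice of a subset
   of a single member [S v] of the family, and [T \subset S w] costs [q ^+ #|T|]
   while moving [T] into the random set only gains [p ^- #|T|]. *)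
Lemma expected_large_frag :
  \sum_W product_weight a W * (\sum_(w | P w && (g < #|frag W w|)%N) mu w)
    <= x ^- g.+1 * (1 + x * (q / p)) ^+ l.
Proof.
(* One member contained in [Z], chosen from [Z] alone; the empty set is the default when there is
   none. *)
pose hZ (Z : {set X}) : {set X} :=
  if [pick v | P v && (S v \subset Z)] is Some v then S v else finset.set0.
pose ok (Z T : {set X}) := (T \subset hZ Z) && (g < #|T|)%N.
have qp0 : 0 <= q / p by rewrite divr_ge0 // ltW.
have x0 : 0 < x by apply: lt_le_trans x_ge1.
(* The members are grouped by their fragment [T]; as [T] lies in [S w], spreadness bounds the mass
   of a group. *)
apply: (@le_trans _ _ (\sum_W \sum_(T | minimal_frag W T && (g < #|T|)%N)
                          product_weight a W * q ^+ #|T|)).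
  apply: ler_sum => W _; rewrite -mulr_sumr; apply: ler_wpM2l; first exact: product_weight_ge0.
  rewrite (partition_big (frag W) (fun T => minimal_frag W T && (g < #|T|)%N)) /=.
    apply: ler_sum => T _; apply: le_trans (spr T); apply: ler_sum_pred => // w.
    by case/andP=> /andP[Pw _] /eqP <-; rewrite Pw; have [] := fragP W Pw.
  by move=> w /andP[Pw ->]; have [->] := fragP W Pw.
apply: (@le_trans _ _ (\sum_Z \sum_(T | ok Z T) product_weight a Z * (q / p) ^+ #|T|)).
  rewrite (exchange_big_dep xpredT) //= [leRHS](exchange_big_dep xpredT) //=.
  apply: ler_sum => T _.
  (* For fixed [T] this map is injective on the sets disjoint from [T], and the weight of [W] is at
     most [p ^- #|T|] times that of [W :|: T]. *)
  apply: (ler_sum_inj (u := fun W => W :|: T)).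
  - move=> W1 W2; rewrite !unfold_in.
    move=> /andP[/and3P[/eqP d1 _ _] _] /andP[/and3P[/eqP d2 _ _] _] eqU.
    apply/setP => e; move/setP/(_ e): eqU; move/setP/(_ e): d1; move/setP/(_ e): d2.
    by rewrite !inE; case: (e \in W1); case: (e \in W2); case: (e \in T).
  - move=> W /andP[/and3P[_ /existsP[v vP] /forallP minT] ltT].
    rewrite /ok ltT andbT /hZ; case: pickP => [u uP|/(_ v)]; last by rewrite vP.
    by have := minT u; rewrite uP.
  - move=> W /andP[/and3P[/eqP d /existsP[v vP] /forallP minT] ltT].
    have TSv : T \subset S v by have := minT v; rewrite vP.
    rewrite expr_div_n mulrA mulrAC; apply: ler_wpM2r; first exact: exprn_ge0.
    rewrite ler_pdivlMr ?exprn_gt0 //.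
    rewrite -prodr_const big_mkcond /= /product_weight -big_split /=.
    apply: ler_prod => e _.
    have /andP[a0 a1] := pa e.
    move/setP/(_ e): d; rewrite !inE.
    case: (boolP (e \in T)) => [eT|_]; rewrite /= ?andbT ?orbT ?orbF ?mulr1.
      move=> ->; rewrite (aS (w := v)) ?(fintype.subsetP TSv) //; last by case/andP: vP.
      have p0 := ltW p_gt0.
      apply/andP; split; first by rewrite mulr_ge0 ?subr_ge0.
      by rewrite ler_piMl // gerBl.
    by move=> _; case: (e \in W); rewrite ?lexx ?andbT //; lra.
  - move=> Z _; apply: mulr_ge0; [exact: product_weight_ge0 | exact: exprn_ge0].
rewrite -[leRHS]mul1r -[X in _ <= X * _](sum_product_weight a) mulr_suml; apply: ler_sum => Z _.
rewrite -mulr_sumr; apply: ler_wpM2l; first exact: product_weight_ge0.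
(* Since [#|T| > g] and [x >= 1], the inserted factor [x ^+ #|T| / x ^+ g.+1] is at least 1;
   afterwards the sum may run over all subsets of [hZ Z]. *)
apply: (@le_trans _ _ (\sum_(T | ok Z T) x ^- g.+1 * (x * (q / p)) ^+ #|T|)).
  apply: ler_sum => T /andP[_ gT]; rewrite [(x * _) ^+ _]exprMn mulrA; apply: ler_peMl.
    exact: exprn_ge0.
  rewrite mulrC ler_pdivlMr ?exprn_gt0 // mul1r.
  exact: ler_weXn2l.
rewrite -mulr_sumr; apply: ler_wpM2l; first by rewrite invr_ge0 exprn_ge0 // ltW.
have xqp : 0 <= x * (q / p) by rewrite mulr_ge0 // ltW.
apply: (@le_trans _ _ (\sum_(T : {set X} | T \subset hZ Z) (x * (q / p)) ^+ #|T|)).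
  apply: ler_sum_pred => T; first by case/andP.
  by move=> _; exact: exprn_ge0.
rewrite sum_subsets_exp ler_weXn2l ?lerDl //.
rewrite /hZ; case: pickP => [v /andP[Pv _]|_]; first exact: leS.
by rewrite finset.cards0.
Qed.

End Fragments.

(** * Iterating the fragment step over several rounds *)

Section Rounds.
Variables (R : realFieldType) (X Om : finType) (mu : Om -> R).
Hypothesis mu_ge0 : forall w, 0 <= mu w.
Variables (a : X -> R) (q p : R) (b k : nat).
Hypothesis pa : prob_fun a.
Hypotheses (q_gt0 : 0 < q) (b_gt0 : (0 < b)%N).
Hypotheses (pE : p = b%:R ^+ 2 * q) (p_le1 : p <= 1).
Hypothesis b_large : (1 + b%:R^-1) ^+ b <= b%:R :> R.

Definition covered (P : pred Om) (S : Om -> {set X}) (W : {set X}) :=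
  [exists w, P w && (S w \subset W)].

Let b0 : 0 < b%:R :> R. Proof. by rewrite ltr0n. Qed.
Let p0 : 0 < p. Proof. by rewrite pE mulr_gt0 ?exprn_gt0. Qed.
Let b1 : 1 <= b%:R :> R. Proof. by rewrite ler1n. Qed.
Let bqp : b%:R * (q / p) = b%:R^-1.
Proof. by rewrite pE; field; rewrite !lt0r_neq0. Qed.

Lemma prob_fun_iter r : prob_fun (iter r (union_prob a) a).
Proof. by elim: r => //= r IH; exact: prob_fun_union_prob. Qed.

(** Induction on the rounds. In one round the expected mass of members with a fragment larger than
    [k * b ^ r] is at most [1 / b]. Hence, outside an event of probability at most [2 / (b * m)],
    the small fragments keep mass [m / 2], and they are still spread, being subsets of the old
    members. *)
Lemma uncovered_le (r : nat) (P : pred Om) (S : Om -> {set X}) (m : R) :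
  0 < m -> m <= \sum_(w | P w) mu w ->
  (forall w e, P w -> e \in S w -> a e = p) ->
  (forall w, P w -> (#|S w| <= k * b ^ r)%N) ->
  spread P S mu q ->
  \sum_(W : {set X}) product_weight (iter r (union_prob a) a) W * (~~ covered P S W)%:R
    <= 4 ^+ r * 2 ^+ k / (b%:R * m).
Proof.
elim: r P S m => [|r IH] P S m m0 mass aS leS spr.
  have leS0 w : P w -> (#|S w| <= k)%N by move/leS; rewrite expn0 muln1.
  have := expected_large_frag mu_ge0 0 pa aS leS0 spr p0 p_le1 (ltW q_gt0) b1.
  rewrite bqp expr1 => key.
  rewrite expr0 mul1r ler_pdivlMr ?mulr_gt0 // mulrCA mulr_suml -ler_pdivlMl //.
  apply: le_trans (le_trans key _).
    apply: ler_sum => W _; rewrite -mulrA; apply: ler_wpM2l; first exact: product_weight_ge0.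
    case: (boolP (covered P S W)) => [_|ncov]; rewrite ?mul0r ?mul1r.
      exact: sumr_ge0.
    (* If [W] contains no member then no fragment is empty, so the whole mass counts as bad. *)
    apply: le_trans mass _; apply: ler_sum_pred => // w Pw; rewrite Pw /= lt0n.
    rewrite cards_eq0; apply: contra ncov => /eqP frag0.
    have [_ _ [v Pv]] := fragP S W Pw; rewrite frag0 finset.setU0 => sub.
    by apply/existsP; exists v; rewrite Pv.
  rewrite ler_wpM2l ?invr_ge0 ?ler0n // lerXn2r ?nnegrE ?addr_ge0 ?invr_ge0 ?ler0n //.
  have : b%:R^-1 <= 1 :> R by rewrite invf_le1.
  lra.
pose g := (k * b ^ r)%N.
have leS1 w : P w -> (#|S w| <= b * g)%N.
  by move/leS; rewrite /g mulnCA -expnS.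
have := expected_large_frag mu_ge0 g pa aS leS1 spr p0 p_le1 (ltW q_gt0) b1.
rewrite bqp => key.
have {}key : \sum_W product_weight a W *
    (\sum_(w | P w && (g < #|frag P S W w|)%N) mu w) <= b%:R^-1.
  apply: le_trans key _.
  (* As [(1 + 1 / b) ^ b <= b], the power with exponent [b * g] is at most [b ^ g], one factor [b]
     short of the denominator. *)
  rewrite exprM exprSr invfM mulrAC ler_pdivrMr // mulVf ?lt0r_neq0 //.
  rewrite mulrC ler_pdivrMr ?exprn_gt0 // mul1r.
  by rewrite lerXn2r ?nnegrE ?exprn_ge0 ?addr_ge0 ?invr_ge0 ?ler0n.
pose B := 4 ^+ r * 2 ^+ k / (b%:R * (m / 2)).
have B0 : 0 <= B.
  by rewrite /B divr_ge0 ?mulr_ge0 ?exprn_ge0 ?ler0n ?divr_ge0 ?ltW.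
rewrite /= sum_product_weight_setU.
apply: (@le_trans _ _ (\sum_W product_weight a W *
   (2 / m * (\sum_(w | P w && (g < #|frag P S W w|)%N) mu w) + B))).
  apply: ler_sum => W _; apply: ler_wpM2l; first exact: product_weight_ge0.
  set bad := \sum_(w | P w && _) _.
  have bad0 : 0 <= bad by exact: sumr_ge0.
  have m20 : 0 < m / 2 by rewrite divr_gt0.
  (* Markov's inequality: if half of the mass is bad, the trivial bound 1 is charged to [bad];
     otherwise the induction hypothesis applies to the small fragments. *)
  have [large|small] := lerP (m / 2) bad.
    apply: (@le_trans _ _ 1).
      rewrite -[leRHS](sum_product_weight (iter r (union_prob a) a)); apply: ler_sum => E _.
      apply: ler_piMr; first exact/product_weight_ge0/prob_fun_iter.
      by rewrite lern1 leq_b1.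
    rewrite -[leLHS]addr0 lerD //.
    rewrite mulrAC ler_pdivlMr // mul1r; lra.
  rewrite -[leLHS]add0r lerD ?mulr_ge0 ?invr_ge0 ?(ltW m0) //.
  have := IH [pred w | P w && (#|frag P S W w| <= g)%N] (frag P S W) _ m20.
  move=> IHW; apply: le_trans (IHW _ _ _ _).
  - apply: ler_sum => E _; apply: ler_wpM2l; first exact/product_weight_ge0/prob_fun_iter.
    case: (boolP (covered _ (frag P S W) E)); last by rewrite ler_nat leq_b1.
    case/existsP=> w /andP[/andP[Pw _] sub].
    suff -> : covered P S (W :|: E) by [].
    have [_ _ [v Pv vsub]] := fragP S W Pw.
    apply/existsP; exists v; rewrite Pv; apply: fintype.subset_trans vsub _.
    exact: finset.setUS.
  - move: mass; rewrite (bigID (fun w => (#|frag P S W w| <= g)%N)) /=.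
    rewrite [X in _ <= _ + X -> _](eq_bigl (fun w => P w && (g < #|frag P S W w|)%N)).
      by rewrite -/bad; lra.
    by move=> w; rewrite -ltnNge.
  - move=> w e /andP[Pw _] ew; apply: (aS w) => //.
    by have [_ sub _] := fragP S W Pw; exact: (fintype.subsetP sub).
  - by move=> w /andP[].
  - move=> A; apply: le_trans (spr A); apply: ler_sum_pred => // w.
    case/andP=> /andP[Pw _] sub; rewrite Pw; apply: fintype.subset_trans sub _.
    by have [] := fragP S W Pw.
under eq_bigr do rewrite mulrDr mulrCA.
rewrite big_split /= -mulr_sumr -mulr_suml sum_product_weight mul1r.
apply: (@le_trans _ _ (2 / m * b%:R^-1 + B)).
  by rewrite lerD2r ler_wpM2l // divr_ge0 // ltW.
rewrite /B exprS.
have -> : 4 * 4 ^+ r * 2 ^+ k / (b%:R * m) = 4 ^+ r * 2 ^+ k * 4 / (b%:R * m) :> R.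
  by field; rewrite !lt0r_neq0.
have -> : 2 / m / b%:R + 4 ^+ r * 2 ^+ k / (b%:R * (m / 2))
    = (2 + 4 ^+ r * 2 ^+ k * 2) / (b%:R * m) :> R.
  by field; rewrite !lt0r_neq0.
have bm0 : 0 < b%:R * m by rewrite mulr_gt0.
rewrite ler_wpM2r ?invr_ge0 ?(ltW bm0) //.
have : 1 <= 4 ^+ r * 2 ^+ k :> R.
  by rewrite mulr_ege1 ?exprn_ege1 ?ler1n.
move: (4 ^+ r * 2 ^+ k) => Y; lra.
Qed.

End Rounds.

(** * Probability of containing a given graph *)

Lemma connect_crossing (V : finType) (e : rel V) (U : {set V}) x y :
  connect e x y -> x \in U -> y \notin U ->
  exists u v, [/\ connect e x u, e u v, u \in U & v \notin U].
Proof.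
case/connectP=> p; elim: p x => [|z p IH] x /=; first by move=> _ -> ->.
case/andP=> exz zp lastp xU yU; have [zU|zU] := boolP (z \in U).
  have [u [v [zu euv uU vU]]] := IH z zp lastp zU yU.
  by exists u, v; split=> //; apply: connect_trans zu; exact: connect1.
by exists x, z; split.
Qed.

Section ForestBound.
Variables (R : realFieldType) (V Pos Om : finType).
Variables (mu : Om -> R) (P : pred Om) (pos : Om -> V -> Pos) (c : R).
Hypothesis mu_ge0 : forall w, 0 <= mu w.
Hypothesis c_ge0 : 0 <= c.
Hypothesis vertex_spread : forall (U : {set V}) (phi : V -> Pos),
  \sum_(w | P w && [forall x in U, pos w x == phi x]) mu w <= c ^+ #|U|.
Variables (near : rel Pos) (K : nat).
Hypothesis near_deg : forall i, (#|[set j | near i j]| <= K)%N.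
Variables (e : rel V) (rho : V -> V).
Hypothesis rho_conn : forall x, connect e x (rho x).
Hypothesis rho_const : forall x y, connect e x y -> rho x = rho y.
Hypothesis e_sym : symmetric e.
Hypothesis c_large : 1 <= #|Pos|%:R * c.

Definition respects w := [forall x, forall y, e x y ==> near (pos w x) (pos w y)].

(** [rho] selects one root in each component, so [#|N|] is the number of vertices minus the number
    of components. *)
Let N := [set x | rho x != x].
Let B (U : {set V}) (phi : V -> Pos) :=
  \sum_(w | P w && (respects w && [forall x in U, pos w x == phi x])) mu w.
Let upd (phi : V -> Pos) z i := fun x => if x == z then i else phi x.

Let reveal (U : {set V}) phi z (Q : {set Pos}) (beta : R) :
  z \notin U -> (forall w, respects w -> [forall x in U, pos w x == phi x] ->
    pos w z \in Q) ->
  (forall i, B (z |: U) (upd phi z i) <= beta) -> 0 <= beta ->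
  B U phi <= #|Q|%:R * beta.
Proof.
move=> zU inQ leb b0; rewrite /B.
rewrite (partition_big (fun w => pos w z) (fun i => i \in Q)) /=; last first.
  by move=> w /andP[_ /andP[? ?]]; exact: inQ.
rewrite mulr_natl -sumr_const; apply: ler_sum => i _.
apply: le_trans (leb i); apply: ler_sum_pred => // w.
case/andP=> /andP[-> /andP[-> /forall_inP posU]] /eqP posz /=.
apply/forall_inP => x; rewrite finset.in_setU1 /upd.
case: eqP => [-> _|_ /= xU]; [exact/eqP | exact: posU].
Qed.

(** With the roots revealed, some edge joins a revealed vertex to an unrevealed one, which then has
    at most [K] possible positions; each further prescribed position contributes a factor [c]. *)
Let grow m (U : {set V}) phi : #|N :\: U| = m -> rho @: N \subset U ->
  B U phi <= c ^+ #|U| * (K%:R * c) ^+ m.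
Proof.
elim: m U phi => [|m IH] U phi card_m rootsU.
  rewrite mulr1; apply: le_trans (vertex_spread U phi); apply: ler_sum_pred => // w.
  by case/andP=> -> /andP[_ ->].
have [x] : exists x, x \in N :\: U by apply/card_gt0P; rewrite card_m.
rewrite finset.in_setD => /andP[xU xN].
have rxU : rho x \in U.
  by apply: (fintype.subsetP rootsU); apply/finset.imsetP; exists x.
have csym : connect_sym e by exact: sym_connect_sym.
have rx_x : connect e (rho x) x by rewrite csym.
have [u [z [ru euz uU zU]]] := connect_crossing rx_x rxU xU.
have xz : rho x = rho z.
  apply: rho_const; apply: connect_trans (rho_conn x) _.
  exact: connect_trans ru (connect1 euz).
have zN : z \in N.
  by rewrite inE; apply: contra zU => /eqP <-; rewrite -xz.
have beta0 : 0 <= c ^+ #|U|.+1 * (K%:R * c) ^+ m.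
  by rewrite mulr_ge0 ?exprn_ge0 ?mulr_ge0.
apply: (@le_trans _ _ (#|[set j | near (phi u) j]|%:R
    * (c ^+ #|U|.+1 * (K%:R * c) ^+ m))).
  apply: (reveal (z := z)) => //.
  - move=> w /forallP/(_ u)/forallP/(_ z); rewrite euz /= => nw /forall_inP/(_ u uU)/eqP <-.
    by rewrite inE.
  - move=> i; have -> : #|U|.+1 = #|z |: U| by rewrite finset.cardsU1 zU.
    apply: IH.
      have := cardsD1 z (N :\: U).
      rewrite finset.in_setD zU zN card_m add1n => -[->]; congr #|pred_of_set _|.
      by apply/setP => y; rewrite !inE negb_or andbA.
    by apply: fintype.subset_trans rootsU _; exact: finset.subsetUr.
apply: (@le_trans _ _ (K%:R * (c ^+ #|U|.+1 * (K%:R * c) ^+ m))).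
  by apply: ler_wpM2r => //; rewrite ler_nat near_deg.
by rewrite le_eqVlt; apply/orP; left; apply/eqP; rewrite !exprS; ring.
Qed.

(** Nothing confines a root, so all [#|Pos|] positions enter the union bound. *)
Let grow_roots m (U : {set V}) phi : #|rho @: N :\: U| = m -> U \subset rho @: N ->
  B U phi <= #|Pos|%:R ^+ m * (c ^+ #|rho @: N| * (K%:R * c) ^+ #|N|).
Proof.
have beta0 : 0 <= c ^+ #|rho @: N| * (K%:R * c) ^+ #|N|.
  by rewrite mulr_ge0 ?exprn_ge0 ?mulr_ge0.
elim: m U phi => [|m IH] U phi card_m Uroots.
  have UE : U = rho @: N.
    apply/eqP; rewrite finset.eqEsubset Uroots -finset.setD_eq0.
    by rewrite -cards_eq0 card_m.
  rewrite mul1r -UE; apply: grow; last by rewrite UE.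
  congr #|pred_of_set _|; rewrite UE; apply/setP => x; rewrite finset.in_setD.
  case: (boolP (x \in N)); rewrite ?andbF ?andbT // => xN.
  apply/negP => /finset.imsetP[y yN xy]; move: xN; rewrite inE xy.
  by rewrite -(rho_const (rho_conn y)) eqxx.
have [z] : exists z, z \in rho @: N :\: U by apply/card_gt0P; rewrite card_m.
rewrite finset.in_setD => /andP[zU zN].
rewrite exprS -mulrA -cardsT; apply: (reveal (z := z)) => // [i|].
  rewrite cardsT; apply: IH; last by rewrite finset.subUset finset.sub1set zN.
  have := cardsD1 z (rho @: N :\: U).
  rewrite finset.in_setD zU zN card_m add1n => -[->]; congr #|pred_of_set _|.
  by apply/setP => y; rewrite !inE negb_or andbA.
by rewrite mulr_ge0 ?exprn_ge0.
Qed.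

(* Union bound over the positions of the nontrivial roots, then over those of the
   other vertices, each revealed next to an already revealed neighbour. *)
Lemma sum_respects_le :
  \sum_(w | P w && respects w) mu w
    <= ((#|Pos|%:R * c) * (K%:R * c)) ^+ #|[set x | rho x != x]|.
Proof.
rewrite -/N; have /card_gt0P[i0 _] : (0 < #|Pos|)%N.
  rewrite lt0n; apply: contraTN c_large => /eqP ->.
  by rewrite mul0r ler10.
have := @grow_roots #|rho @: N| finset.set0 (fun=> i0).
rewrite finset.setD0 finset.sub0set => /(_ erefl isT) key.
apply: le_trans (le_trans key _).
  rewrite /B; apply: ler_sum_pred => // w /andP[-> ->] /=.
  by apply/forall_inP => x; rewrite inE.
rewrite mulrA -exprMn [leRHS]exprMn; apply: ler_wpM2r.
  by rewrite exprn_ge0 ?mulr_ge0.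
(* There are at most as many nontrivial roots as non-roots, and the base is at least 1 by
   [c_large]. *)
by rewrite ler_weXn2l // leq_imset_card.
Qed.

End ForestBound.

(** * Sequentially chosen permutations *)

Section FallingFactorial.
Variable R : realType.

Lemma expR1_ge1 : 1 <= expR 1 :> R.
Proof. by apply: le_trans (expR_ge1Dx 1); rewrite lerDl. Qed.

Lemma exp_succ_inv_le (r : nat) : (1 + r%:R^-1) ^+ r <= expR 1 :> R.
Proof.
case: r => [|r]; first by rewrite expr0 expR1_ge1.
apply: (@le_trans _ _ (expR (r.+1%:R^-1) ^+ r.+1)).
  rewrite lerXn2r ?nnegrE ?expR_ge0 ?addr_ge0 ?invr_ge0 ?ler0n //.
  exact: expR_ge1Dx.
by rewrite -expRM_natl mulfV ?pnatr_eq0.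
Qed.

(** Induction on both arguments: replacing [m] by [m + 1] in the [t]-th power costs
    [(1 + 1 / m) ^ t], at most [e] because [t <= m]. *)
Lemma expn_le_ffact (m t : nat) : (t <= m)%N ->
  m%:R ^+ t <= expR 1 ^+ t * (m ^_ t)%:R :> R.
Proof.
elim: t m => [|t IH] [|m] // letm; rewrite ?ffactn0 ?mulr1 //.
have {}IH := IH m letm.
rewrite ffactSS natrM exprS [leRHS]mulrCA; apply: ler_wpM2l; first exact: ler0n.
case: m => [|m] in letm IH *.
  by case: t letm {IH} => // _; rewrite ffactn0 mulr1 expr0 expr1 expR1_ge1.
have -> : m.+2%:R = m.+1%:R * (1 + m.+1%:R^-1) :> R.
  by rewrite mulrDr mulr1 mulfV ?pnatr_eq0 // -[m.+2]addn1 natrD.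
rewrite exprMn exprS -mulrA [leRHS]mulrC; apply: ler_pM => //.
apply: le_trans (exp_succ_inv_le m.+1); apply: ler_weXn2l => //.
by rewrite lerDl invr_ge0 ler0n.
Qed.

End FallingFactorial.

Section SequentialPermutation.
Variables (R : realType) (V : finType) (prv : V -> V) (ok : V -> rel V).
Implicit Types (d : {set V}) (s t : {perm V}) (ps : seq V).

(** Partial choices are kept as full permutations: [x] moves to [j] and the old value takes its
    place. Only the values at processed positions are final. *)
Definition swap_in (j x : V) s : {perm V} := (tperm j ((s^-1)%g x) * s)%g.

Definition avail d j s : {set V} :=
  [set x | ((s^-1)%g x \notin d) && ok j (s (prv j)) x].

(* Expectation of [F] when the values at the positions [ps] are chosen one after
   the other, uniformly among the available ones, and the values outside the
   processed positions are finally permuted uniformly. *)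
Fixpoint seq_expect ps d s (F : {perm V} -> R) : R :=
  if ps is j :: ps' then
    #|avail d j s|%:R^-1 *
      \sum_(x in avail d j s) seq_expect ps' (j |: d) (swap_in j x s) F
  else #|perm_on (~: d)|%:R^-1 * \sum_(u in perm_on (~: d)) F (u * s)%g.

Lemma swap_in_at j x s : swap_in j x s j = x.
Proof. by rewrite permM tpermL permKV. Qed.

Lemma swap_in_done d j x s i : j \notin d -> x \in avail d j s -> i \in d ->
  swap_in j x s i = s i.
Proof.
move=> jd; rewrite inE => /andP[xd _] id; rewrite permM tpermD //.
  by apply: contraNneq jd => ->.
by apply: contraNneq xd => ->.
Qed.

(** Turns the recursion into a sum against weights of single permutations, which will serve as the
    measure. *)
Lemma seq_expect_sum ps d s F : seq_expect ps d s F =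
  \sum_t seq_expect ps d s (fun t' => (t' == t)%:R) * F t.
Proof.
elim: ps d s => [|j ps IH] d s /=.
  under [RHS]eq_bigr do rewrite -mulrA mulr_suml.
  rewrite -mulr_sumr exchange_big /=; congr (_ * _); apply: eq_bigr => u _.
  rewrite (bigD1 (u * s)%g) //= eqxx mul1r big1 ?addr0 // => t.
  by rewrite eq_sym => /negbTE ->; rewrite mul0r.
under [RHS]eq_bigr do rewrite -mulrA mulr_suml.
rewrite -mulr_sumr exchange_big /=; congr (_ * _); apply: eq_bigr => x _.
exact: IH.
Qed.

Lemma seq_expect_le ps d s F G : uniq ps -> {in ps, forall j, j \notin d} ->
  (forall t, {in d, t =1 s} -> F t <= G t) ->
  seq_expect ps d s F <= seq_expect ps d s G.
Proof.
elim: ps d s => [|j ps IH] d s /= ups psd FG; rewrite ler_wpM2l ?invr_ge0 ?ler0n //.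
  apply: ler_sum => u ud; apply: FG => i id; rewrite permM (out_perm ud) //.
  by rewrite inE id.
case/andP: ups => jps ups.
have jd : j \notin d by apply: psd; rewrite mem_head.
apply: ler_sum => x xav; apply: IH => // [i ips|t tE].
  rewrite finset.in_setU1 negb_or psd ?inE ?ips ?orbT // andbT.
  by apply: contraNneq jps => <-.
apply: FG => i id; rewrite tE ?finset.in_setU1 ?id ?orbT //.
exact: swap_in_done xav id.
Qed.

Lemma seq_expect0 ps d s : seq_expect ps d s (fun=> 0) = 0.
Proof.
elim: ps d s => [|j ps IH] d s /=; first by rewrite big1_eq mulr0.
by rewrite big1 ?mulr0.
Qed.

(** [D] is the set of sequentially filled positions; [c] bounds the price of prescribing one value,
    in a sequential choice or in the final uniform permutation. *)
Variables (D : {set V}) (c : R).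
Hypothesis c_gt0 : 0 < c.
Hypothesis avail_large : forall d j s, d \subset D -> c^-1 <= #|avail d j s|%:R.
Hypothesis D_proper : (#|D| < #|V|)%N.
Hypothesis c_fill : expR 1 / #|~: D|%:R <= c.

Let avail_gt0 d j s : d \subset D -> 0 < #|avail d j s|%:R :> R.
Proof. by move=> dD; apply: lt_le_trans (avail_large j s dD); rewrite invr_gt0. Qed.

(** When a constraint at [j] is imposed, the value at [prv j] must already be final. *)
Fixpoint ordered ps d :=
  if ps is j :: ps' then
    ((forall y x, ok j y x) \/ prv j \in d) /\ ordered ps' (j |: d)
  else True.

Definition constrained t := [forall j in D, ok j (t (prv j)) (t j)].

Lemma seq_expect_constrained ps d s : uniq ps -> {in ps, forall j, j \notin d} ->
  d :|: [set j in ps] = D -> ordered ps d ->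
  {in d, forall j, (forall y x, ok j y x) \/ prv j \in d} ->
  {in d, forall j, ok j (s (prv j)) (s j)} ->
  1 <= seq_expect ps d s (fun t => (constrained t)%:R).
Proof.
elim: ps d s => [|j ps IH] d s /= ups psd dD ord closed oks.
  have perm_gt0 : 0 < #|perm_on (~: d)|%:R :> R by rewrite card_perm ltr0n fact_gt0.
  rewrite ler_pdivlMl // mulr1 -sumr_const; apply: ler_sum => u ud.
  suff -> : constrained (u * s)%g by [].
  apply/forall_inP => i; rewrite -dD !inE orbF => id.
  have uE x : x \in d -> (u * s)%g x = s x.
    by move=> xd; rewrite permM (out_perm ud) // inE xd.
  case: (closed i id) => [free|pid]; first exact: free.
  by rewrite !uE //; exact: oks.
case/andP: ups => jps ups; case: ord => ordj ord.
have jd : j \notin d by apply: psd; rewrite mem_head.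
have dsub : d \subset D by rewrite -dD finset.subsetUl.
rewrite ler_pdivlMl ?avail_gt0 // mulr1 -sumr_const; apply: ler_sum => x xav.
have sE := swap_in_done jd xav.
apply: IH => //.
- move=> i ips; rewrite finset.in_setU1 negb_or psd ?inE ?ips ?orbT // andbT.
  by apply: contraNneq jps => <-.
- by rewrite -dD; apply/setP => i; rewrite !inE; case: (i == j); rewrite ?orbT ?orbF.
- move=> i; rewrite finset.in_setU1 => /orP[/eqP ->|id].
    by case: ordj => [?|pd]; [left | right; rewrite finset.in_setU1 pd orbT].
  by case: (closed i id) => [?|pd]; [left | right; rewrite finset.in_setU1 pd orbT].
- move=> i; rewrite finset.in_setU1 => /orP[/eqP ->|id].
    case: ordj => [free|pd]; first exact: free.
    by rewrite swap_in_at sE //; move: xav; rewrite inE => /andP[].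
  case: (closed i id) => [free|pd]; first exact: free.
  by rewrite !sE //; exact: oks.
Qed.

(** Multiplying by the inverse of one such permutation [u0] gives permutations that also fix the
    prescribed positions outside [D]. *)
Lemma card_perm_on_prescribed s (U : {set V}) (phi : V -> V) : {in U &, injective phi} ->
  (#|[set u in perm_on (~: D) | [forall x in U, (u * s)%g (phi x) == x]]|
    <= (#|~: D| - #|[set x in U | phi x \notin D]|)`!)%N.
Proof.
move=> phiI; set W := [set x in U | _]; set A := [set u in _ | _].
have -> : (#|~: D| - #|W|)%N = #|~: D :\: phi @: W|.
  rewrite cardsDS ?card_in_imset //.
    by move=> x y; rewrite !inE => /andP[xU _] /andP[yU _]; exact: phiI.
  by apply/fintype.subsetP => y /finset.imsetP[x]; rewrite !inE => /andP[_ ?] ->.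
rewrite -card_perm; case: (set_0Vmem A) => [->|[u0 u0A]]; first by rewrite finset.cards0.
rewrite -(card_imset (mem A) (mulIg u0^-1%g)); apply: subset_leq_card.
apply/fintype.subsetP => v /finset.imsetP[u uA ->].
move: u0A uA; rewrite !inE => /andP[u0D /forall_inP u0U] /andP[uD /forall_inP uU].
apply/fintype.subsetP => i; rewrite inE permM => fix_i; rewrite !inE; apply/andP; split.
  apply: contraNN fix_i => /finset.imsetP[x]; rewrite inE => /andP[xU _] ->.
  have := uU x xU; have := u0U x xU; rewrite !permM => /eqP {2}<- /eqP/perm_inj ->.
  by rewrite permK.
apply: contraNN fix_i => iD.
have iE w : perm_on (~: D) w -> w i = i.
  by move=> wD; rewrite (out_perm wD) // inE iD.
by rewrite (iE u uD) -{1}(iE u0 u0D) permK.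
Qed.

(** A prescribed sequential position has at most one good choice among at least [1 / c]. Among the
    [M] positions left at the end, prescribing [v] costs [(M - v)! / M!], at most [(e / M) ^ v]. *)
Lemma seq_expect_spread ps d s (U : {set V}) (phi : V -> V) :
  {in U &, injective phi} -> uniq ps -> {in ps, forall j, j \notin d} ->
  d :|: [set j in ps] = D ->
  seq_expect ps d s (fun t => [forall x in U, t (phi x) == x]%:R)
    <= c ^+ #|[set x in U | phi x \notin d]|.
Proof.
move=> phiI; elim: ps d s => [|j ps IH] d s /= ups psd dD.
  have {dD psd ups} -> : d = D by rewrite -dD; apply/setP => i; rewrite !inE orbF.
  have perm_gt0 : 0 < #|perm_on (~: D)|%:R :> R by rewrite card_perm ltr0n fact_gt0.
  set W := [set x in U | _].
  have leW : (#|W| <= #|~: D|)%N.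
    rewrite -(@card_in_imset _ _ phi) //.
      apply: subset_leq_card; apply/fintype.subsetP => y /finset.imsetP[x].
      by rewrite !inE => /andP[_ ?] ->.
    by move=> x y; rewrite !inE => /andP[xU _] /andP[yU _]; exact: phiI.
  rewrite ler_pdivrMl //.
  apply: (@le_trans _ _ (#|~: D| - #|W|)`!%:R).
    rewrite -natr_sum ler_nat; apply: leq_trans (card_perm_on_prescribed s phiI).
    rewrite -sum1_card big_mkcond [leqRHS]big_mkcond /=; apply: leq_sum => u _.
    by rewrite !inE; case: (u \in _) => //; case: ifP.
  rewrite card_perm -(ffact_fact leW) natrM [_%:R * _]mulrC -mulrA.
  rewrite -[leLHS]mulr1; apply: ler_wpM2l; first exact: ler0n.
  have m0 : 0 < #|~: D|%:R :> R.
    by rewrite ltr0n -(leq_add2l #|D|) cardsC addn1.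
  apply: (@le_trans _ _ ((#|~: D| ^_ #|W|)%:R * (expR 1 / #|~: D|%:R) ^+ #|W|)).
    rewrite expr_div_n mulrA ler_pdivlMr ?exprn_gt0 // mul1r mulrC.
    exact: expn_le_ffact.
  apply: ler_wpM2l; first exact: ler0n.
  by rewrite lerXn2r // nnegrE ?divr_ge0 ?expR_ge0 // ltW.
case/andP: ups => jps ups.
have jd : j \notin d by apply: psd; rewrite mem_head.
have dsub : d \subset D by rewrite -dD finset.subsetUl.
have psd' : {in ps, forall i, i \notin j |: d}.
  move=> i ips; rewrite finset.in_setU1 negb_or psd ?inE ?ips ?orbT // andbT.
  by apply: contraNneq jps => <-.
have dD' : j |: d :|: [set i in ps] = D.
  by rewrite -dD; apply/setP => i; rewrite !inE; case: (i == j); rewrite ?orbT ?orbF.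
have {}IH x := IH (j |: d) (swap_in j x s) ups psd' dD'.
rewrite ler_pdivrMl ?avail_gt0 //.
(* If [j] is the position prescribed for [x0], every choice other than [x0] makes the indicator
   vanish. *)
case: (boolP [exists x0 in U, phi x0 == j]) => [/existsP[x0 /andP[x0U /eqP phix0]]|noj].
  apply: (@le_trans _ _ (c ^+ #|[set x in U | phi x \notin j |: d]|)).
    case: (boolP (x0 \in avail d j s)) => [x0av|x0av]; last first.
      rewrite big1_seq ?exprn_ge0 ?(ltW c_gt0) // => x /andP[xav _].
      apply/eqP; rewrite eq_le; apply/andP; split.
        rewrite -(seq_expect0 ps (j |: d) (swap_in j x s)); apply: seq_expect_le => // t tE.
        case: (boolP [forall x in U, _]) => // /forall_inP/(_ x0 x0U).
        rewrite phix0 tE ?finset.setU11 // swap_in_at => /eqP xx0.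
        by rewrite xx0 (negbTE x0av) in xav.
      rewrite -(seq_expect0 ps (j |: d) (swap_in j x s)); apply: seq_expect_le => //.
    rewrite (bigD1 x0) //= -[leRHS]addr0; apply: lerD => //.
    apply: sumr_le0 => x /andP[xav xx0].
    rewrite -(seq_expect0 ps (j |: d) (swap_in j x s)); apply: seq_expect_le => // t tE.
    case: (boolP [forall x in U, _]) => // /forall_inP/(_ x0 x0U).
    by rewrite phix0 tE ?finset.setU11 // swap_in_at (negbTE xx0).
  have -> : #|[set x in U | phi x \notin d]| = #|[set x in U | phi x \notin j |: d]|.+1.
    rewrite (cardsD1 x0) inE x0U phix0 jd add1n; congr _.+1; congr #|pred_of_set _|.
    apply/setP => x; rewrite !inE negb_or; case: (boolP (x \in U)); rewrite ?andbF //= => xU.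
    by congr (~~ _ && _); apply/eqP/eqP => [->//|]; rewrite -phix0; exact: phiI.
  rewrite exprS mulrA ler_peMl ?exprn_ge0 ?(ltW c_gt0) //.
  by rewrite -ler_pdivrMr // mul1r avail_large.
apply: (@le_trans _ _ (\sum_(x in avail d j s) c ^+ #|[set x in U | phi x \notin d]|)).
  apply: ler_sum => x _; apply: le_trans (IH x) _.
  rewrite le_eqVlt; apply/orP; left; apply/eqP; congr (_ ^+ #|pred_of_set _|).
  apply/setP => y; rewrite !inE negb_or; case: (boolP (y \in U)) => //= yU.
  suff -> : phi y != j by [].
  by apply: contra noj => ?; apply/existsP; exists y; rewrite yU.
by rewrite sumr_const mulr_natl.
Qed.

End SequentialPermutation.

(** * Powers of cycles *)

Section CyclicPower.
Local Open Scope nat_scope.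

(* For [i, j < n], cyclic distance at most [k] modulo [n]. *)
Definition near (n k i j : nat) : bool :=
  [|| (i <= j + k) && (j <= i + k), i + n <= j + k | j + n <= i + k].

Lemma near_sym n k i j : near n k i j = near n k j i.
Proof. by rewrite /near andbC; case: (_ && _) => //=; rewrite orbC. Qed.

Lemma near_le n k l i j : k <= l -> near n k i j -> near n l i j.
Proof. by rewrite /near; lia. Qed.

Lemma card_near n k (i : 'I_n) : #|[set j : 'I_n | near n k i j]| <= 4 * k + 1.
Proof.
pose s := iota (i - k) (2 * k + 1) ++ iota (i + n - k) k ++ iota 0 k.
have -> : 4 * k + 1 = size s by rewrite !size_cat !size_iota; lia.
rewrite cardE -(size_map val); apply: uniq_leq_size.
  by rewrite map_inj_uniq ?enum_uniq //; exact: val_inj.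
move=> m /mapP[j]; rewrite mem_enum inE /near => nij ->.
have := ltn_ord i; have := ltn_ord j.
by rewrite !mem_cat !mem_iota /=; lia.
Qed.

Lemma modn_lt_double n x : x < n + n -> x %% n = if x < n then x else x - n.
Proof.
move=> lt; case: ltnP => le; first exact: modn_small.
by rewrite -{1}(subnK le) modnDr modn_small //; lia.
Qed.

Lemma near_rot n k r i j : i < n -> j < n -> r < n -> near n k i j ->
  near n k ((i + r) %% n) ((j + r) %% n).
Proof.
move=> ltin ltjn ltrn nij.
rewrite (modn_lt_double (n := n) (x := i + r)); last by lia.
rewrite (modn_lt_double (n := n) (x := j + r)); last by lia.
by move: nij; rewrite /near; do 2 case: ifP; lia.
Qed.

Variables (n k : nat).
Implicit Types (t : {perm 'I_n}) (x y : 'I_n).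

Definition position t x : 'I_n := (t^-1)%g x.

Definition power_edges t : {set {set 'I_n}} :=
  [set e | [exists x, exists y, [&& x != y, e == [set x; y]
                                  & near n k (position t x) (position t y)]]].

Lemma adj_power_edges t (A : {set {set 'I_n}}) x y : A \subset power_edges t ->
  adj A x y -> near n k (position t x) (position t y).
Proof.
move=> sub axy; have := fintype.subsetP sub _ axy; rewrite inE.
case/existsP=> u /existsP[v /and3P[uv /eqP exy nuv]].
have ux : x \in [set u; v] by rewrite -exy finset.set21.
have uy : y \in [set u; v] by rewrite -exy finset.set22.
have xu : u \in [set x; y] by rewrite exy finset.set21.
have xv : v \in [set x; y] by rewrite exy finset.set22.
move: ux uy xu xv; rewrite !inE.
case/orP=> /eqP ->; case/orP=> /eqP -> //; rewrite ?(near_sym _ _ (position t v)) //.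
  by rewrite !orbb => _ /eqP vu; rewrite vu eqxx in uv.
by rewrite !orbb => /eqP vu; rewrite vu eqxx in uv.
Qed.

Lemma power_edges_pairs t : power_edges t \subset pairs 'I_n.
Proof.
apply/fintype.subsetP => e; rewrite !inE => /existsP[x /existsP[y /and3P[xy /eqP -> _]]].
by rewrite finset.cards2 xy.
Qed.

Section Cycle.
Variable t : {perm 'I_n}.

Lemma next_codom x y : next (codom t) x == y ->
  (position t y : nat) = (position t x).+1
  \/ (position t x).+1 = n /\ (position t y : nat) = 0.
Proof.
have [i ->] : exists i, x = t i by exists (position t x); rewrite /position permKV.
have -> : position t (t i) = i by rewrite /position permK.
have uc : uniq (codom t) by rewrite map_inj_uniq ?enum_uniq //; exact: perm_inj.
have sz : size (codom t) = n by rewrite size_codom card_ord.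
have nthc x0 (j : 'I_n) : nth x0 (codom t) j = t j.
  by rewrite (nth_map j) ?size_enum_ord // nth_ord_enum.
have idx : index (t i) (codom t) = i.
  by rewrite -(nthc (t i) i) index_uniq ?sz.
have i_lt : i < size (codom t) by rewrite sz.
rewrite next_nth codom_f idx.
case ec: (codom t) => [|z c]; first by rewrite ec in i_lt.
have [lt|ge] := ltnP i.+1 n.
  have -> : nth z c i = nth z (codom t) (Ordinal lt) by rewrite ec.
  by rewrite nthc => /eqP <-; left; rewrite /position permK.
have szc : size c <= i by have := sz; rewrite ec /=; lia.
have n0 : 0 < n by have := ltn_ord i; lia.
rewrite nth_default // => /eqP <-; right; split; first by have := ltn_ord i; lia.
have -> : z = nth z (codom t) (Ordinal n0) by rewrite ec.
by rewrite nthc /position permK.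
Qed.

Lemma walk_near x (p : seq 'I_n) : path (cycle_graph (codom t)) x p ->
  near n (size p) (position t x) (position t (last x p)).
Proof.
elim/last_ind: p => [|p z IH]; first by move=> _; rewrite /near /= !addn0 leqnn.
rewrite rcons_path last_rcons size_rcons => /andP[/IH{IH}].
set y := last x p; rewrite /cycle_graph /= /near => nxy /and3P[_ _ yz].
have := ltn_ord (position t x); have := ltn_ord (position t y).
have := ltn_ord (position t z); move: nxy.
by case/orP: yz => /next_codom; lia.
Qed.

Lemma power_edges_hamilton (E : {set {set 'I_n}}) : 2 < n -> k < n ->
  power_edges t \subset E -> has_hamilton_power k E.
Proof.
move=> n2 kn sub; apply/existsP; exists (codom_tuple t); apply/andP; split.
  apply/and3P; split; first by rewrite map_inj_uniq ?enum_uniq //; exact: perm_inj.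
    by rewrite size_tuple.
  by rewrite card_ord.
apply/forallP => x; apply/forallP => y; apply/implyP => /and3P[xy _ dxy].
apply: (fintype.subsetP sub); rewrite inE.
apply/existsP; exists x; apply/existsP; exists y; rewrite xy eqxx /=.
(* The bound [k < n] excludes the default value of [gdist], so a walk of length at most [k]
   exists. *)
have has_walk : has (walk (cycle_graph (codom_tuple t)) x y) (iota 0 #|'I_n|).
  rewrite has_find size_iota; apply: leq_ltn_trans dxy _.
  by rewrite card_ord.
have := nth_find 0 has_walk; rewrite nth_iota; last first.
  by move: has_walk; rewrite has_find size_iota.
rewrite add0n => /existsP[p /andP[xp /eqP lastp]].
by have := walk_near xp; rewrite lastp size_tuple; apply: near_le.
Qed.

End Cycle.

(** * Cutting the cycle open *)

Section Cut.
Variables (L : nat) (t : {perm 'I_n}) (A : {set {set 'I_n}}).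
Hypothesis k_ge2 : 2 <= k.
Hypothesis L_ge2 : 2 <= L.
Hypothesis n_large : 2 * k ^ 4 * L.+2 + k ^ 3 + k + L + 2 <= n.
Hypothesis A_power : A \subset power_edges t.
Hypothesis missing : forall i j : 'I_n, j = i.+1 :> nat -> i %% L = 0 ->
  [set t i; t j] \notin A.

(** Rotating the positions by [r] moves the place where the cycle is opened into a path. *)
Let rpos r x := (position t x + r) %% n.
(** The edges spanning the cut: near cyclically but not linearly. *)
Let crossing r : {set {set 'I_n}} :=
  [set e in A | [exists x, exists y, (e == [set x; y]) && (rpos r x + k < rpos r y)]].

Let rposI r : injective (rpos r).
Proof.
move=> x y /eqP; rewrite /rpos eqn_modDr !modn_small ?ltn_ord // => /eqP /val_inj.
exact: perm_inj.
Qed.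

Let rpos_lt r x : rpos r x < n.
Proof. by rewrite ltn_mod (leq_ltn_trans _ (ltn_ord x)). Qed.

Let sub_power r : A :\: crossing r \subset power_edges t.
Proof. exact: fintype.subset_trans (finset.subsetDl _ _) A_power. Qed.

Let window r : r < n -> forall x,
  (forall i, i <= L.+1 -> exists y, rpos r y + i = rpos r x) ->
  exists y z, [/\ rpos r z = (rpos r y).+1, rpos r x <= rpos r y + L.+1,
    rpos r z <= rpos r x & ~~ adj (A :\: crossing r) z y].
Proof.
move=> rn x run; have [y0 y0x] := run _ (leqnn _).
have px := rpos_lt r x.
set p := rpos r x in y0x px *.
have ltL : L.+1 <= p by lia.
pose u := p - L.+1.
pose o := if r <= u then u - r else u + n - r.
have on : o < n by rewrite /o; case: ifP; lia.
(* The first multiple of [L] from [o] on or, if the window may reach the end of the ordering, [n],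
   which stands for position 0. So [L] need not divide [n]. *)
have [m [om mo mL mn]] : exists m, [/\ o <= m, m <= o + L, (m %% n) %% L = 0 & (m %% n).+1 < n].
  have [le|gt] := leqP (o + L.+1) n; last first.
    by exists n; rewrite modnn mod0n; split; lia.
  exists ((o + L.-1) %/ L * L).
  have := divn_eq (o + L.-1) L; have : (o + L.-1) %% L < L by rewrite ltn_mod; lia.
  move=> lt eq; have small : (o + L.-1) %/ L * L < n by lia.
  by rewrite (modn_small small) modnMl; split; lia.
have mn0 : m %% n < n by lia.
have mE : m %% n = if m < n then m else m - n by apply: modn_lt_double; lia.
exists (t (Ordinal mn0)), (t (Ordinal mn)).
have Pm : rpos r (t (Ordinal mn0)) = u + (m - o).
  rewrite /rpos /position permK /= modn_lt_double; last by lia.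
  by rewrite mE /o in om mo *; move: om mo; do 3 case: ifP; lia.
have Pm1 : rpos r (t (Ordinal mn)) = (u + (m - o)).+1.
  rewrite /rpos /position permK /= modn_lt_double; last by lia.
  by rewrite mE /o in mn om mo *; move: om mo mn; do 3 case: ifP; lia.
rewrite Pm Pm1; split; try (rewrite /u; lia).
rewrite adj_sym /adj /= finset.in_setD negb_and; apply/orP; right.
exact: missing.
Qed.

Let cut_bound r : r < n ->
  #|A :\: crossing r| * L.+2 + #|late (A :\: crossing r) (rpos r)|
    <= k * L.+2 * #|late (A :\: crossing r) (rpos r)|.
Proof.
move=> rn; apply: card_edges_late => //.
- exact: fintype.subset_trans (sub_power r) (power_edges_pairs t).
- move=> x y axy.
  have := near_rot (ltn_ord _) (ltn_ord _) rn (adj_power_edges (sub_power r) axy).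
  rewrite -/(rpos r x) -/(rpos r y) => nxy.
  have axyA : [set x; y] \in A by move: axy; rewrite /adj /= finset.in_setD => /andP[].
  have : [set x; y] \notin crossing r by move: axy; rewrite /adj /= finset.in_setD => /andP[].
  rewrite inE axyA /= negb_exists => /forallP/(_ x); rewrite negb_exists => /forallP/(_ y).
  by rewrite eqxx /=; lia.
- exact: window.
Qed.

(** A crossing edge joins one of the first [k] rotated positions to one of the last [k]. *)
Let card_crossing r : r < n -> #|crossing r| <= k ^ 2.
Proof.
move=> rn.
pose I1 := [set x | rpos r x < k]; pose I2 := [set y | n - k <= rpos r y].
have c1 : #|I1| <= k.
  rewrite -(size_iota 0 k) cardE -(size_map (rpos r)); apply: uniq_leq_size.
    by rewrite map_inj_uniq ?enum_uniq.
  by move=> i /mapP[x]; rewrite mem_enum inE mem_iota => ? ->; lia.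
have c2 : #|I2| <= k.
  rewrite -(size_iota (n - k) k) cardE -(size_map (rpos r)); apply: uniq_leq_size.
    by rewrite map_inj_uniq ?enum_uniq.
  by move=> i /mapP[x]; rewrite mem_enum inE mem_iota => ? ->; have := rpos_lt r x; lia.
apply: leq_trans (_ : #|finset.setX I1 I2| <= _); last by rewrite cardsX -mulnn leq_mul.
apply: leq_trans (leq_imset_card (fun p : 'I_n * 'I_n => [set p.1; p.2]) _).
apply: subset_leq_card; apply/fintype.subsetP => e; rewrite inE => /andP[eA].
case/existsP=> x /existsP[y /andP[/eqP exy cr]].
apply/finset.imsetP; exists (x, y) => //; rewrite finset.in_setX !inE /=.
have axy : adj A x y by rewrite /adj /= -exy.
have := near_rot (ltn_ord _) (ltn_ord _) rn (adj_power_edges A_power axy).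
rewrite -/(rpos r x) -/(rpos r y) /near.
have := rpos_lt r x; have := rpos_lt r y; lia.
Qed.

(** Let [y] follow [x] within [k] steps around the cycle; the edge crosses only if [x] is among the
    last [k] rotated positions. *)
Let few_cuts e : e \in A -> #|[set r : 'I_n | e \in crossing r]| <= k.
Proof.
move=> eA; have := fintype.subsetP A_power _ eA; rewrite inE.
case/existsP=> x0 /existsP[y0 /and3P[_ /eqP exy0 n0]].
have [x [y [exy nxy]]] : exists x y, e = [set x; y] /\
    (position t x <= position t y <= position t x + k \/
     position t y + n <= position t x + k).
  have := ltn_ord (position t x0); have := ltn_ord (position t y0).
  move: n0; rewrite /near => n0 lty ltx.
  have [le|gt] := leqP (position t x0) (position t y0).
    have [le2|gt2] := leqP (position t y0) (position t x0 + k).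
      by exists x0, y0; split=> //; left; rewrite le.
    by exists y0, x0; split; [rewrite exy0 finset.setUC | right; lia].
  have [le2|gt2] := leqP (position t x0) (position t y0 + k).
    by exists y0, x0; split; [rewrite exy0 finset.setUC | left; lia].
  by exists x0, y0; split => //; right; lia.
rewrite -(size_iota (n - k) k) cardE.
rewrite -(size_map (fun r : 'I_n => rpos r x)); apply: uniq_leq_size.
  rewrite map_inj_uniq ?enum_uniq // => r r' /eqP.
  by rewrite /rpos eqn_modDl !modn_small ?ltn_ord // => /eqP /val_inj.
move=> i /mapP[r]; rewrite mem_enum inE inE => /andP[_].
case/existsP=> u /existsP[v /andP[/eqP euv cr]] ->.
have ltn_r := ltn_ord r; have ltn_x := ltn_ord (position t x).
have ltn_y := ltn_ord (position t y).
have uxy : u \in [set x; y] by rewrite -exy euv finset.set21.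
have vxy : v \in [set x; y] by rewrite -exy euv finset.set22.
move: uxy vxy cr; rewrite mem_iota !inE.
case/orP=> /eqP ->; case/orP=> /eqP ->; rewrite /rpos !modn_lt_double; try lia;
  move: nxy; do 2 case: ifP; lia.
Qed.

(* Cut the cycle where no edge of [A] crosses; if every cut is crossed then [A] has
   at least [n / k] edges and the at most [k ^ 2] edges crossing one cut do not matter. *)
Lemma card_edges_cut : exists (A' : {set {set 'I_n}}) (rho : 'I_n -> 'I_n),
  [/\ A' \subset A, forall x, connect (adj A') x (rho x),
      forall x y, connect (adj A') x y -> rho x = rho y
    & 2 * L.+2 * #|A| + #|[set x | rho x != x]|
        <= 2 * k * L.+2 * #|[set x | rho x != x]| ].
Proof.
have n0 : 0 < n by lia.
have [r rn bound] : exists2 r, r < n &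
    2 * L.+2 * #|A| + #|late (A :\: crossing r) (rpos r)|
      <= 2 * k * L.+2 * #|late (A :\: crossing r) (rpos r)|.
  case: (boolP [exists r : 'I_n, crossing r == finset.set0]) => [/existsP[r /eqP cr0]|].
    exists r => //; have := cut_bound (ltn_ord r); rewrite cr0 finset.setD0.
    by lia.
  rewrite negb_exists => /forallP allcross.
  exists 0 => //; have := cut_bound n0; have := card_crossing n0.
  have := finset.cardsD A (crossing 0).
  have -> : A :&: crossing 0 = crossing 0.
    by apply/finset.setIidPr/fintype.subsetP => e; rewrite inE => /andP[].
  (* Double counting of pairs of a cut and an edge crossing it. *)
  have : n <= k * #|A|.
    rewrite -[leqLHS]card_ord -[leqLHS]sum1_card (eq_bigl xpredT) //.
    apply: leq_trans (_ : \sum_(r : 'I_n) \sum_(e in A) (e \in crossing r) <= _).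
      apply: leq_sum => r _; have /set0Pn[e ecr] := allcross r.
      have eA : e \in A by move: ecr; rewrite inE => /andP[].
      by rewrite (bigD1 e) //= ecr.
    rewrite exchange_big /= mulnC -sum_nat_const; apply: leq_sum => e eA.
    apply: leq_trans (few_cuts eA); rewrite -sum1_card [leqRHS]big_mkcond /=.
    by apply: leq_sum => r _; rewrite [X in if X then _ else _]inE; case: ifP.
  set N := #|late _ _|; set a := #|A|; set a' := #|A :\: _|; set cr := #|crossing 0|.
  move: n_large; set w := L.+2 => large na aE crk bnd.
  have kN : a' <= k * N.
    by rewrite -(leq_pmul2r (m := w)) // mulnAC; apply: leq_trans bnd; exact: leq_addr.
  have aN : a <= k * N + k ^ 2 by lia.
  have k2N : n <= k ^ 2 * N + k ^ 3.
    apply: (leq_trans na); apply: (leq_trans (n := k * (k * N + k ^ 2))).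
      by rewrite leq_mul2l aN orbT.
    by rewrite mulnDr mulnA mulnn -expnS.
  (* Doubling the bound for the uncrossed edges leaves a spare [N], which absorbs the
     [2 * w * k ^ 2] due to the crossing ones. *)
  have N_large : 2 * k ^ 2 * w <= N.
    rewrite -(leq_pmul2l (m := k ^ 2)); last by rewrite expn_gt0; lia.
    have -> : k ^ 2 * (2 * k ^ 2 * w) = 2 * k ^ 4 * w.
      by rewrite (expnD k 2 2); lia.
    by lia.
  have le_wa : w * a <= w * (a' + k ^ 2) by rewrite leq_mul2l; lia.
  by lia.
pose A' := A :\: crossing r.
(* The root is the leftmost vertex of its component in the rotated order, so the non-roots are the
   late vertices. *)
pose rho x := [arg min_(y < x | connect (adj A') x y) rpos r y].
have rhoP x : connect (adj A') x (rho x) /\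
    forall y, connect (adj A') x y -> rpos r (rho x) <= rpos r y.
  by rewrite /rho; case: arg_minnP => // y xy ymin; split.
have csym := adj_connect_sym A'.
exists A', rho; split.
- exact: finset.subsetDl.
- by move=> x; case: (rhoP x).
- move=> x y xy; apply: (@rposI r); apply/eqP; rewrite eqn_leq.
  have [xr xmin] := rhoP x; have [yr ymin] := rhoP y.
  rewrite xmin ?(connect_trans xy) // ymin //.
  by apply: connect_trans xr; rewrite csym.
- suff -> : [set x | rho x != x] = late A' (rpos r) by [].
  apply/setP => x; rewrite !inE; have [xr xmin] := rhoP x.
  apply/idP/existsP => [neq|[y /andP[xy lt]]].
    exists (rho x); rewrite xr ltn_neqAle xmin // andbT.
    by apply: contra neq => /eqP/rposI ->.
  by apply: contraTneq lt => <-; rewrite -leqNgt xmin.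
Qed.

End Cut.

End CyclicPower.

(** * Orderings with planted edges *)

Section PlantedPermutation.
Variables (R : realType) (n k L m : nat) (G : {set {set 'I_n}}).

(** The value at 0 is a default; for [L >= 2], constraints occur only at [j] congruent to 1 modulo
    [L]. *)
Definition pred_pos (j : 'I_n) : 'I_n := Ordinal (leq_ltn_trans (leq_pred j) (ltn_ord j)).

(* Positions [i] with [L %| i] and [i.+1] are to receive the ends of an edge of [G]. *)
Definition planted_ok (j : 'I_n) : rel 'I_n :=
  fun y x => (j %% L == 1)%N ==> adj G y x.

Definition planted_pos : {set 'I_n} := [set j : 'I_n | (j %% L < 2)%N].

Definition planted_seq : seq 'I_n := [seq j : 'I_n <- enum 'I_n | (j %% L < 2)%N].

Definition planted : pred {perm 'I_n} := constrained pred_pos planted_ok planted_pos.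

Definition planted_weight (t : {perm 'I_n}) : R :=
  seq_expect pred_pos planted_ok planted_seq finset.set0 1%g (fun t' => (t' == t)%:R).

Hypothesis L_ge2 : (2 <= L)%N.
Hypothesis m_gt0 : (0 < m)%N.
Hypothesis n_gt0 : (0 < n)%N.
Hypothesis degG : forall v, (m + 2 * (n %/ L).+1 <= degree G v)%N.

Lemma card_planted_pos : (#|planted_pos| <= 2 * (n %/ L).+1)%N.
Proof.
rewrite mulnC cardE -(size_map val).
rewrite -[X in (_ <= _ * X)%N](size_iota 0 2) -[X in (_ <= X * _)%N](size_iota 0).
rewrite -(size_allpairs (fun i j => i * L + j)%N); apply: uniq_leq_size.
  by rewrite map_inj_uniq ?enum_uniq //; exact: val_inj.
move=> i /mapP[j]; rewrite mem_enum inE => jL ->.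
apply/allpairsP; exists ((j %/ L)%N, (j %% L)%N); split.
- by rewrite mem_iota add0n ltnS leq_div2r // ltnW.
- by rewrite mem_iota.
- by rewrite /= -divn_eq.
Qed.

Lemma planted_seq_uniq : uniq planted_seq.
Proof. by rewrite filter_uniq ?enum_uniq. Qed.

Lemma planted_seqE : finset.set0 :|: [set j in planted_seq] = planted_pos.
Proof. by apply/setP => j; rewrite !inE mem_filter mem_enum andbT. Qed.

Lemma ordered_sorted (ps : seq 'I_n) (d : {set 'I_n}) :
  sorted (fun i j : 'I_n => (i < j)%N) ps ->
  {in ps, forall j : 'I_n, (j %% L == 1)%N -> pred_pos j \in d :|: [set i in ps]} ->
  ordered pred_pos planted_ok ps d.
Proof.
elim: ps d => [|j ps IH] d //= sps closed.
have trans : transitive (fun i j : 'I_n => (i < j)%N) by move=> ? ? ?; exact: ltn_trans.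
have /allP lt_ps := order_path_min trans sps.
split; last first.
  apply: IH; first exact: path_sorted sps.
  move=> i ips iL; have := closed i; rewrite !inE ips orbT => /(_ isT iL).
  by case: (_ == j); case: (_ \in d).
case: (boolP (j %% L == 1)%N) => jL; last by left=> y x; rewrite /planted_ok (negbTE jL).
right; have := closed j; rewrite mem_head => /(_ isT jL); rewrite !inE.
have j0 : (0 < j)%N by case: (nat_of_ord j) jL => //; rewrite mod0n.
case/or3P=> // [/eqP/(congr1 val) /=|/lt_ps /=]; lia.
Qed.

(** A planted choice costs at most [1 / m]; the factor [e] is for the final uniform permutation. *)
Let c : R := expR 1 / m%:R.
Let m0 : 0 < m%:R :> R. Proof. by rewrite ltr0n. Qed.
Let c_gt0 : 0 < c. Proof. by rewrite divr_gt0 ?expR_gt0. Qed.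

Let card_done : (m + #|planted_pos| <= n)%N.
Proof.
apply: leq_trans (_ : degree G (Ordinal n_gt0) <= _)%N.
  by apply: leq_trans (degG _); rewrite leq_add2l card_planted_pos.
by rewrite -[leqRHS]card_ord max_card.
Qed.

Let avail_large (d : {set 'I_n}) (j : 'I_n) s : d \subset planted_pos ->
  c^-1 <= #|avail pred_pos planted_ok d j s|%:R.
Proof.
move=> dsub; apply: (@le_trans _ _ m%:R).
  by rewrite /c invf_div ler_pdivrMr ?expR_gt0 // ler_peMr ?ler0n ?expR1_ge1.
rewrite ler_nat; have le_d := subset_leq_card dsub.
have cd := card_planted_pos; have cdone := card_done.
pose nb := [set x | adj G (s (pred_pos j)) x].
have le1 : (m + #|planted_pos| <= #|nb|)%N.
  by apply: leq_trans (degG (s (pred_pos j))); rewrite leq_add2l.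
apply: (@leq_trans #|nb :\: [set s i | i in d]|).
  rewrite cardsD; have : (#|nb :&: [set s i | i in d]| <= #|planted_pos|)%N.
    apply: leq_trans le_d; apply: leq_trans (leq_imset_card s d).
    exact/subset_leq_card/finset.subsetIr.
  by move: le1; move: #|nb| #|planted_pos| #|_ :&: _| => a b e; lia.
apply: subset_leq_card; apply/fintype.subsetP => x; rewrite !inE => /andP[xd nbx].
rewrite /planted_ok nbx implybT andbT; apply: contra xd => xd.
by apply/finset.imsetP; exists ((s^-1)%g x); rewrite ?permKV.
Qed.

Let D_proper : (#|planted_pos| < #|'I_n|)%N.
Proof. by have := card_done; rewrite card_ord; lia. Qed.

Let c_fill : expR 1 / #|~: planted_pos|%:R <= c.
Proof.
rewrite /c ler_wpM2l ?expR_ge0 // lef_pV2 ?posrE ?ltr0n //.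
  by rewrite ler_nat; have := cardsC planted_pos; have := card_done; rewrite card_ord; lia.
by have := cardsC planted_pos; have := card_done; rewrite card_ord; lia.
Qed.

Let not_in0 : {in planted_seq, forall j, j \notin finset.set0}.
Proof. by move=> j _; rewrite inE. Qed.

Lemma planted_weight_ge0 t : 0 <= planted_weight t.
Proof.
rewrite -(seq_expect0 R pred_pos planted_ok planted_seq finset.set0 1%g).
exact: seq_expect_le planted_seq_uniq not_in0 _.
Qed.

Lemma planted_mass : 1 <= \sum_(t | planted t) planted_weight t.
Proof.
have ord : ordered pred_pos planted_ok planted_seq finset.set0.
  apply: ordered_sorted.
    apply: sorted_filter; first by move=> ? ? ?; exact: ltn_trans.
    by have := iota_ltn_sorted 0 n; rewrite -val_enum_ord sorted_map.
  move=> j _ jL; rewrite planted_seqE inE /=.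
  case: (nat_of_ord j) jL => [|i]; rewrite ?mod0n //= => /eqP iL.
  have : (i %% L == 0 %[mod L])%N.
    by rewrite modn_mod -(eqn_modDr 1) addn1 iL add0n modn_small.
  by rewrite modn_mod mod0n => /eqP ->.
have := seq_expect_constrained (c := c) c_gt0 avail_large (s := 1%g) planted_seq_uniq
  not_in0 planted_seqE ord.
move=> /(_ _ _); rewrite seq_expect_sum.
have -> : \sum_t planted_weight t * (planted t)%:R = \sum_(t | planted t) planted_weight t.
  rewrite [RHS]big_mkcond; apply: eq_bigr => t _.
  by case: ifP; rewrite ?mulr1 ?mulr0.
by apply=> j; rewrite inE.
Qed.

Lemma planted_spread (U : {set 'I_n}) (phi : 'I_n -> 'I_n) :
  \sum_(t | planted t && [forall x in U, position t x == phi x]) planted_weight t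
    <= c ^+ #|U|.
Proof.
(* Distinct vertices have distinct positions, so the event is empty unless [phi] is injective on
   [U]. *)
case: (boolP (dinjectiveb phi (mem U))) => [/dinjectiveP phiI|ninj]; last first.
  rewrite big_pred0 ?exprn_ge0 ?(ltW c_gt0) // => t.
  apply/negP => /andP[_ /forall_inP posU]; case/negP: ninj.
  apply/dinjectiveP => x y xU yU; rewrite -(eqP (posU x xU)) -(eqP (posU y yU)).
  exact: perm_inj.
have := seq_expect_spread c_gt0 avail_large D_proper c_fill 1%g phiI planted_seq_uniq
  not_in0 planted_seqE.
rewrite seq_expect_sum => spr; apply: le_trans (le_trans spr _); last first.
  rewrite (_ : [set x in U | _] = U) //.
  by apply/setP => x; rewrite !inE andbT.
rewrite big_mkcond; apply: ler_sum => t _ /=; rewrite -/(planted_weight t).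
have -> : [forall x in U, position t x == phi x] = [forall x in U, t (phi x) == x].
  apply/eq_forallb => x; congr (_ ==> _); apply/eqP/eqP => [<-|tx].
    by rewrite /position permKV.
  by apply: (@perm_inj _ t); rewrite /position permKV.
case: (planted t) => /=; last by rewrite mulr_ge0 ?planted_weight_ge0.
by case: [forall x in U, _]; rewrite ?mulr1 ?mulr0.
Qed.

End PlantedPermutation.

(** * The random graph *)

Section GnpCoupling.
Variables (R : realFieldType) (T : finType).

Definition gnp_fun (p : R) (e : {set T}) : R := if e \in pairs T then p else 0.

Lemma prob_fun_gnp p : 0 <= p <= 1 -> prob_fun (gnp_fun p).
Proof. by move=> p01 e; rewrite /gnp_fun; case: ifP; rewrite // lexx ler01. Qed.

(** Coupling: a set with law [a'] is the union of one with law [a] and an independent one, and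
    enlarging the set does not increase [f]. *)
Lemma product_weight_mono (X : finType) (a a' : X -> R) (f : {set X} -> R) :
  prob_fun a -> prob_fun a' -> (forall e, a e <= a' e) ->
  (forall E F, f (E :|: F) <= f E) ->
  \sum_E product_weight a' E * f E <= \sum_E product_weight a E * f E.
Proof.
move=> pa pa' le_aa' anti.
(* Where [a e = 1] the quotient is 0, which is right because [a' e = 1] as well. *)
pose b e := (a' e - a e) / (1 - a e).
have pb : prob_fun b.
  move=> e; have /andP[a0 a1] := pa e; have /andP[a'0 a'1] := pa' e.
  rewrite /b divr_ge0 ?subr_ge0 //=; have := le_aa' e => le1.
  have [->|ne1] := eqVneq (a e) 1; first by rewrite subrr invr0 mulr0 ler01.
  rewrite ler_pdivrMr ?mul1r; last by rewrite subr_gt0 lt_neqAle ne1.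
  by rewrite lerD2r.
have -> : \sum_E product_weight a' E * f E = \sum_E product_weight (union_prob a b) E * f E.
  apply: eq_bigr => E _; congr (_ * _); apply: eq_bigr => e _.
  suff -> : union_prob a b e = a' e by [].
  rewrite /union_prob /b; have [a1|ne1] := eqVneq (a e) 1.
    have /andP[_ a'1] := pa' e; have := le_aa' e; rewrite a1 => le1.
    by rewrite subrr invr0 !mulr0 addr0 subr0; apply/eqP; rewrite eq_le le1.
  by field; rewrite subr_eq0 eq_sym.
rewrite sum_product_weight_setU; apply: ler_sum => E _; apply: ler_wpM2l; first exact: product_weight_ge0.
apply: (@le_trans _ _ (\sum_F product_weight b F * f E)).
  by apply: ler_sum => F _; apply: ler_wpM2l; [exact: product_weight_ge0 | exact: anti].
by rewrite -mulr_suml sum_product_weight mul1r.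
Qed.

Lemma iter_union_prob_le (X : finType) (a : X -> R) r e : prob_fun a ->
  iter r (union_prob a) a e <= r.+1%:R * a e.
Proof.
move=> pa; elim: r => [|r IH] /=; first by rewrite mul1r.
have /andP[i0 i1] := prob_fun_iter pa r e; have /andP[a0 a1] := pa e.
rewrite /union_prob -addn1 natrD mulrDl mul1r.
apply: (@le_trans _ _ (a e + iter r (union_prob a) a e)); last by rewrite addrC lerD2r.
by rewrite gerBl mulr_ge0.
Qed.

End GnpCoupling.

Lemma gnp_prob_product_weight (R : realType) (T : finType) (p : R) (A : pred {set {set T}}) :
  gnp_prob p A = \sum_E product_weight (gnp_fun p) E * (A E)%:R.
Proof.
rewrite /gnp_prob big_mkcond; apply: eq_bigr => E _.
have [sE|nsE] := boolP (simple_graph E); rewrite /=; last first.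
  have [e eE ne] := subsetPn nsE.
  by rewrite /product_weight (bigD1 e) //= eE /gnp_fun (negbTE ne) !mul0r.
case: (A E); rewrite ?mulr1 ?mulr0 // /gnp_weight /product_weight big_mkcond /=.
apply: eq_bigr => e _; rewrite /gnp_fun; case: ifP => // ne; case: ifP; rewrite ?subr0 //.
by move=> eE; rewrite (fintype.subsetP sE) in ne.
Qed.

(** * The failure probability for fixed parameters *)

Section FiniteBound.
Variables (R : realType) (n k L m b r : nat) (G : {set {set 'I_n}}) (p q : R).
Hypotheses (k_ge2 : (2 <= k)%N) (L_ge2 : (2 <= L)%N) (m_gt0 : (0 < m)%N).
Hypothesis n_large : (2 * k ^ 4 * L.+2 + k ^ 3 + k + L + 2 <= n)%N.
Hypothesis degG : forall v, (m + 2 * (n %/ L).+1 <= degree G v)%N.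
Hypotheses (b_gt0 : (0 < b)%N) (b_large : expR 1 <= b%:R :> R) (b_r : (n <= b ^ r)%N).
Hypotheses (q_gt0 : 0 < q) (p_large : r.+1%:R * (b%:R ^+ 2 * q) <= p) (p_le1 : p <= 1).

Let c : R := expR 1 / m%:R.
(** The price per non-root in the forest bound, of order [1 / n] when [m] is linear in [n]. *)
Let x : R := (n%:R * c) * ((4 * k + 1)%:R * c).
(** Turns a bound by non-roots [N] into one by edges [a], given the sparsity from
    [card_edges_cut]. *)
Hypothesis x_le_q : forall a N : nat,
  (2 * L.+2 * a + N <= 2 * k * L.+2 * N)%N -> x ^+ N <= q ^+ a.

Let S (t : {perm 'I_n}) : {set {set 'I_n}} := power_edges k t :\: G.

Let n_gt0 : (0 < n)%N. Proof. by move: n_large; lia. Qed.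

Let n_gt2k : (2 < n)%N /\ (k < n)%N.
Proof. by move: n_large k_ge2; clear; lia. Qed.

Let missing (A : {set {set 'I_n}}) t : planted L G t -> A \subset S t ->
  forall i j : 'I_n, j = i.+1 :> nat -> (i %% L = 0)%N -> [set t i; t j] \notin A.
Proof.
move=> plt sub i j ij iL; apply/negP => /(fintype.subsetP sub).
rewrite finset.in_setD => /andP[/negP notG _]; apply: notG.
have jL : (j %% L = 1)%N.
  by rewrite ij -addn1 -modnDml iL add0n modn_small.
have := forall_inP plt j; rewrite inE jL => /(_ isT); rewrite /planted_ok jL eqxx /=.
by have -> : pred_pos j = i by apply: val_inj; rewrite /= ij.
Qed.

Let cut (A : {set {set 'I_n}}) t : planted L G t -> A \subset S t ->
  exists (A' : {set {set 'I_n}}) (rho : 'I_n -> 'I_n),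
  [/\ A' \subset A, forall x, connect (adj A') x (rho x),
      forall x y, connect (adj A') x y -> rho x = rho y
    & (2 * L.+2 * #|A| + #|[set x | rho x != x]|
        <= 2 * k * L.+2 * #|[set x | rho x != x]|)%N ].
Proof.
move=> plt sub; have subP : A \subset power_edges k t.
  exact: fintype.subset_trans sub (finset.subsetDl _ _).
exact: (card_edges_cut k_ge2 L_ge2 n_large subP (missing plt sub)).
Qed.

Let size_S t : planted L G t -> (#|S t| <= k * b ^ r)%N.
Proof.
move=> plt; have [A' [rho [_ _ _ bound]]] := cut plt (fintype.subxx _).
have leN : (#|[set x | rho x != x]| <= n)%N by rewrite -[leqRHS]card_ord max_card.
move: bound leN b_r; move: #|S t| #|[set x | rho x != x]| => a N bound leN leb.
have : (2 * L.+2 * a <= 2 * L.+2 * (k * N))%N by lia.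
rewrite leq_pmul2l // => le_a; apply: leq_trans le_a _.
by rewrite leq_mul2l (leq_trans leN leb) orbT.
Qed.

Let c_ge0 : 0 <= c. Proof. by rewrite divr_ge0 ?expR_ge0 ?ler0n. Qed.

Let m_le_n : (m <= n)%N.
Proof.
apply: leq_trans (leq_trans (leq_addr _ _) (degG (Ordinal n_gt0))) _.
by rewrite -[leqRHS]card_ord max_card.
Qed.

(** If no planted [S t] contains [A] the sum is empty. Otherwise [A] is sparse, and every [t] with
    [A] inside [S t] respects the adjacency of [A'], so the forest bound applies. *)
Let spread_S : spread (planted L G) S (planted_weight R L G) q.
Proof.
move=> A; case: (pickP (fun t => planted L G t && (A \subset S t))) => [t0 /andP[pl0 sub0]|none].
  have [A' [rho [A'A rconn rconst bound]]] := cut pl0 sub0.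
  apply: le_trans (x_le_q bound).
  have nc : 1 <= #|'I_n|%:R * c.
    rewrite card_ord /c mulrCA -[leLHS]mulr1 ler_pM ?expR1_ge1 //.
    by rewrite ler_pdivlMr ?mul1r ?ltr0n // ler_nat m_le_n.
  have := sum_respects_le (planted_weight_ge0 R L G) c_ge0
    (planted_spread R L_ge2 m_gt0 n_gt0 degG) (near := fun i j : 'I_n => near n k i j)
    (@card_near n k) rconn rconst (adj_sym A') nc.
  rewrite card_ord; apply: le_trans; apply: ler_sum_pred => t; last first.
    by move=> _; exact: planted_weight_ge0.
  case/andP=> -> sub; apply/forallP => u; apply/forallP => v; apply/implyP.
  apply: adj_power_edges; apply: fintype.subset_trans A'A _.
  by apply: fintype.subset_trans sub _; exact: finset.subsetDl.
by rewrite big_pred0 // exprn_ge0 // ltW.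
Qed.

(** Covering some [S t] suffices, as [G] has the other edges of the cycle power. The [r.+1] rounds
    of density [p0] are dominated by one of density [p]. *)
Lemma gnp_hamilton_power :
  1 - gnp_prob p (fun E => has_hamilton_power k (finset.setU G E))
    <= 4 ^+ r * 2 ^+ k / b%:R.
Proof.
pose p0 : R := b%:R ^+ 2 * q; pose a := gnp_fun (T := 'I_n) p0.
have b0 : 0 < b%:R :> R by rewrite ltr0n.
have p0_gt0 : 0 < p0 by rewrite mulr_gt0 ?exprn_gt0.
have p0_le : p0 <= p.
  apply: le_trans p_large; rewrite -/p0 ler_peMl ?(ltW p0_gt0) //.
  by rewrite ler1n.
have p0_le1 : p0 <= 1 by exact: le_trans p0_le p_le1.
have pa : prob_fun a by apply: prob_fun_gnp; rewrite (ltW p0_gt0).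
have pp : prob_fun (gnp_fun (T := 'I_n) p).
  by apply: prob_fun_gnp; rewrite p_le1 (le_trans (ltW p0_gt0)).
rewrite gnp_prob_product_weight -[X in X - _](sum_product_weight (gnp_fun (T := 'I_n) p)) -sumrB.
pose f E : R := (~~ covered (planted L G) S E)%:R.
apply: (@le_trans _ _ (\sum_E product_weight (gnp_fun p) E * f E)).
  apply: ler_sum => E _; rewrite -[X in X - _]mulr1 -mulrBr; apply: ler_wpM2l; first exact: product_weight_ge0.
  case: (boolP (has_hamilton_power _ _)) => [_|noham]; first by rewrite subrr ler0n.
  rewrite subr0 /f; suff -> : ~~ covered (planted L G) S E by [].
  apply: contra noham => /existsP[t /andP[_ sub]].
  have [n2 kn] := n_gt2k.
  apply: (@power_edges_hamilton n k t) => //.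
  apply/fintype.subsetP => e et; rewrite finset.in_setU; case: (boolP (e \in G)) => //= eG.
  by apply: (fintype.subsetP sub); rewrite finset.in_setD eG.
apply: (@le_trans _ _ (\sum_E product_weight (iter r (union_prob a) a) E * f E)).
  apply: product_weight_mono => //; first exact: prob_fun_iter.
  - move=> e; apply: le_trans (iter_union_prob_le r e pa) _.
    by rewrite /a /gnp_fun; case: ifP => // _; rewrite mulr0.
  - move=> E F; rewrite /f ler_nat.
    case: (boolP (covered _ _ E)) => [/existsP[t /andP[plt sub]]|_]; last by rewrite leq_b1.
    suff -> : covered (planted L G) S (E :|: F) by [].
    apply/existsP; exists t; rewrite plt; apply: fintype.subset_trans sub _.
    exact: finset.subsetUl.
have b_large' : (1 + b%:R^-1) ^+ b <= b%:R :> R.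
  exact: le_trans (exp_succ_inv_le R b) b_large.
have := uncovered_le (planted_weight_ge0 R L G) pa q_gt0 b_gt0 (erefl p0) p0_le1 b_large'
  ltr01 (planted_mass R L_ge2 m_gt0 n_gt0 degG) _ size_S spread_S.
rewrite mulr1; apply=> t e plt; rewrite finset.in_setD => /andP[_ et].
by rewrite /a /gnp_fun (fintype.subsetP (power_edges_pairs k t)).
Qed.

End FiniteBound.

(** * Asymptotics and choice of parameters *)

Local Open Scope classical_set_scope.
Local Open Scope ring_scope.

Section Asymptotics.
Variable R : realType.

Lemma near_powR (g M : R) : 0 < g -> \forall n \near \oo, M <= (n%:R : R) `^ g.
Proof.
move=> g0; near=> n.
have Mn : `|M| `^ g^-1 <= n%:R by near: n; exact: nbhs_infty_ger.
apply: (le_trans (ler_norm M)).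
rewrite -[leLHS](powRr1 (normr_ge0 M)) -[X in _ `^ X <= _](mulVf (lt0r_neq0 g0)) powRrM.
by apply: ge0_ler_powR Mn; rewrite ?nnegrE ?powR_ge0 ?ler0n ?ltW.
Unshelve. all: by end_near. Qed.

(** The hypothesis says that [N] is at least [a] times the exponent of [y], and [y <= 1]. *)
Lemma exprn_le_powR (x y : R) (k w a N : nat) : 0 <= x -> x <= y -> 0 < y -> y <= 1 ->
  (0 < k)%N -> (0 < w)%N ->
  (2 * w * a + N <= 2 * k * w * N)%N ->
  x ^+ N <= (y `^ (2 * w%:R / (2 * k%:R * w%:R - 1))) ^+ a.
Proof.
move=> x0 xy y0 y1 k0 w0 bound.
have den0 : 0 < 2 * k%:R * w%:R - 1 :> R.
  rewrite subr_gt0 -!natrM ltr1n; have : (0 < k * w)%N by rewrite muln_gt0 k0.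
  lia.
apply: (@le_trans _ _ (y ^+ N)); first by rewrite lerXn2r ?nnegrE // ltW.
rewrite -(powR_mulrn _ (ltW y0)) -(powR_mulrn _ (powR_ge0 _ _)) -powRrM.
apply: ger_powR; first by rewrite y0.
rewrite mulrAC ler_pdivrMr // mulrBr mulr1 lerBrDr.
rewrite [N%:R * _]mulrC -!natrM -natrD ler_nat; lia.
Qed.

End Asymptotics.

Theorem theorem1p4 (R : realType) (k : nat) (alpha : R)
    (hk : (2 <= k)%N) (halpha : 0 < alpha) :
  exists eta : R, 0 < eta /\
    forall G : forall n : nat, {set {set 'I_n}},
      (forall n : nat, simple_graph (G n)) ->
      (\forall n \near \oo,
         forall v : 'I_n, alpha * n%:R <= (degree (G n) v)%:R) ->
      (fun n : nat =>
         gnp_prob ((n%:R : R) `^ (- (1 / k%:R) - eta))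
           (fun E : {set {set 'I_n}} =>
              has_hamilton_power k (finset.setU (G n) E)))
        @ \oo --> (1 : R).
Proof.
have k0 : 0 < k%:R :> R by rewrite ltr0n (leq_trans _ hk).
(* Makes the planted positions use up at most [alpha * n / 8 + 2] of each degree. *)
pose L := (Num.truncn (16 / alpha)).+2.
have L_large : 16 / alpha <= L%:R.
  have /andP[_ lt] := truncn_itv (divr_ge0 (ler0n R 16) (ltW halpha)).
  by apply: le_trans (ltW lt) _; rewrite ler_nat.
pose w := L.+2.
have den0 : 0 < 2 * k%:R * w%:R - 1 :> R.
  have : (0 < k * w)%N by rewrite muln_gt0 (leq_trans _ hk).
  by rewrite subr_gt0 -!natrM ltr1n; lia.
(* A quarter of the gain of [beta] over [1 / k]: two quarters pay for [b ^ 2], one for constants and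
   the number of rounds, and one is left as [eta]. *)
pose dl : R := (4 * k%:R * (2 * k%:R * w%:R - 1))^-1.
have dl0 : 0 < dl by rewrite invr_gt0 !mulr_gt0.
have dl20 : 0 < dl / 2 by rewrite divr_gt0.
pose beta : R := 2 * w%:R / (2 * k%:R * w%:R - 1).
have betaE : beta = 1 / k%:R + 4 * dl.
  by rewrite /beta /dl; field; rewrite !lt0r_neq0.
(* Since [b] is at least [n ^ (dl / 2)], this many rounds give [b ^ r >= n]. *)
pose r := (Num.truncn (2 / dl)).+1.
have r_large : 2 / dl <= r%:R.
  have /andP[_ lt] := truncn_itv (divr_ge0 (ler0n R 2) (ltW dl0)).
  exact: ltW.
(* As [m >= alpha * n / 4], the price per non-root is at most [Cx / n]. *)
pose Cx : R := (4 * expR 1 / alpha) ^+ 2 * (4 * k + 1)%:R.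
have Cx0 : 0 < Cx.
  by rewrite mulr_gt0 ?exprn_gt0 ?divr_gt0 ?mulr_gt0 ?expR_gt0 // ltr0n addn1.
exists dl; split=> // G Gsimple Gdeg; apply/cvgrPdist_le => eps eps0; near=> n.
have deg_n : forall v, alpha * n%:R <= (degree (G n) v)%:R by near: n.
have n_large : (2 * k ^ 4 * L.+2 + k ^ 3 + k + L + 2 <= n)%N.
  by near: n; exact: nbhs_infty_ge.
have n_alpha : 16 / alpha <= n%:R by near: n; exact: nbhs_infty_ger.
have n_Cx : Cx <= n%:R by near: n; exact: nbhs_infty_ger.
have n_two : 2 <= n%:R `^ (dl / 2) by near: n; exact: near_powR.
have n_e : expR 1 <= n%:R `^ (dl / 2) by near: n; exact: near_powR.
have n_eps : 4 ^+ r * 2 ^+ k / eps <= n%:R `^ (dl / 2) by near: n; exact: near_powR.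
have n_p : r.+1%:R * Cx `^ beta <= n%:R `^ dl by near: n; exact: near_powR.
have n0 : (0 < n)%N by move: n_large; clear; lia.
have nR0 : 0 < n%:R :> R by rewrite ltr0n.
have nRn0 : n%:R != 0 :> R by rewrite lt0r_neq0.
have nR1 : 1 <= n%:R :> R by rewrite ler1n.
pose b := Num.truncn ((n%:R : R) `^ dl).
have /andP[b_le b_gt] := truncn_itv (powR_ge0 (n%:R : R) dl).
rewrite -/b in b_le b_gt.
have b_ge : n%:R `^ (dl / 2) <= b%:R.
  have powE : n%:R `^ dl = n%:R `^ (dl / 2) * n%:R `^ (dl / 2).
    by rewrite -powRD ?nRn0 ?implybT // -splitr.
  have le2 : n%:R `^ (dl / 2) * 2 <= n%:R `^ (dl / 2) * n%:R `^ (dl / 2).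
    by rewrite ler_wpM2l ?powR_ge0.
  by move: b_gt; rewrite powE -[b.+1%:R]natr1; lra.
pose m := Num.truncn (alpha * n%:R / 2).
have an16 : 16 <= alpha * n%:R by rewrite mulrC -ler_pdivrMr.
have /andP[m_le m_gt] : m%:R <= alpha * n%:R / 2 < m.+1%:R.
  by apply: truncn_itv; rewrite divr_ge0 // (le_trans _ an16).
have m_ge : alpha * n%:R / 4 <= m%:R by move: m_gt; rewrite -[m.+1%:R]natr1; lra.
have mR0 : 0 < m%:R :> R by lra.
have m0 : (0 < m)%N by move: mR0; rewrite ltr0n.
pose p : R := n%:R `^ (- (1 / k%:R) - dl).
pose q : R := (Cx / n%:R) `^ beta.
have y0 : 0 < Cx / n%:R by rewrite divr_gt0.
have y1 : Cx / n%:R <= 1 by rewrite ler_pdivrMr // mul1r.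
have p1 : p <= 1.
  rewrite -(powRr0 n%:R); apply: ler_powR => //.
  have := divr_gt0 (ltr01 (R := R)) k0; lra.
have degm : forall v, (m + 2 * (n %/ L).+1 <= degree (G n) v)%N.
  move=> v; rewrite -(ler_nat R); apply: le_trans (deg_n v).
  have nL : (n %/ L)%:R <= alpha * n%:R / 16.
    have L0 : 0 < L%:R :> R by rewrite ltr0n.
    apply: (@le_trans _ _ (n%:R / L%:R)).
      by rewrite ler_pdivlMr // -natrM ler_nat leq_trunc_div.
    rewrite ler_pdivrMr //.
    have : 0 <= n%:R * (alpha * L%:R - 16).
      by rewrite mulr_ge0 ?ler0n // subr_ge0 mulrC -ler_pdivrMr.
    clear; lra.
  rewrite natrD natrM -[(n %/ L).+1%:R]natr1; lra.
have x_le_q : forall a N : nat, (2 * L.+2 * a + N <= 2 * k * L.+2 * N)%N ->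
    ((n%:R * (expR 1 / m%:R)) * ((4 * k + 1)%:R * (expR 1 / m%:R))) ^+ N <= q ^+ a.
  move=> a N bound; apply: (exprn_le_powR (k := k) (w := w) _ _ y0 y1 (ltnW hk) isT bound).
    by rewrite !mulr_ge0 ?expR_ge0 ?invr_ge0 ?ler0n.
  have nc : n%:R * (expR 1 / m%:R) <= 4 * expR 1 / alpha.
    rewrite mulrA ler_pdivrMr // mulrAC ler_pdivlMr //.
    have : 0 <= expR 1 * (4 * m%:R - alpha * n%:R).
      by rewrite mulr_ge0 ?expR_ge0 // subr_ge0; move: m_ge; clear; lra.
    clear; lra.
  rewrite [leLHS](_ : _ = (n%:R * (expR 1 / m%:R)) ^+ 2 * (4 * k + 1)%:R / n%:R); last first.
    by field; rewrite !lt0r_neq0.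
  rewrite ler_wpM2r ?invr_ge0 ?ler0n // ler_wpM2r ?ler0n //.
  apply: lerXn2r nc; rewrite nnegrE.
    by rewrite mulr_ge0 ?divr_ge0 ?expR_ge0 ?ler0n.
  by rewrite divr_ge0 ?mulr_ge0 ?expR_ge0 // ltW.
have b0 : (0 < b)%N by rewrite -(ltr_nat R); apply: lt_le_trans b_ge; rewrite powR_gt0.
have n_br : (n <= b ^ r)%N.
  rewrite -(ler_nat R) natrX; apply: (@le_trans _ _ ((n%:R `^ (dl / 2)) ^+ r)).
    rewrite -(powR_mulrn _ (powR_ge0 _ _)) -powRrM -[leLHS](powRr1 (ltW nR0)).
    apply: ler_powR => //; rewrite -ler_pdivrMl // invf_div mulr1.
    exact: r_large.
  by rewrite lerXn2r ?nnegrE ?powR_ge0 ?ler0n.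
have p_large : r.+1%:R * (b%:R ^+ 2 * q) <= p.
  have -> : q = Cx `^ beta * n%:R `^ (- beta).
    by rewrite /q powRM ?invr_ge0 ?(ltW Cx0) ?(ltW nR0) // -(powR_inv1 (ltW nR0)) -powRrM mulN1r.
  have -> : p = n%:R `^ dl * (n%:R `^ dl) ^+ 2 * n%:R `^ (- beta).
    rewrite -(powR_mulrn _ (powR_ge0 _ _)) -powRrM -!powRD ?nRn0 ?implybT //.
    by congr (_ `^ _); rewrite betaE; lra.
  rewrite [leLHS](_ : _ = r.+1%:R * Cx `^ beta * b%:R ^+ 2 * n%:R `^ (- beta)); last by ring.
  apply: ler_wpM2r; first exact: powR_ge0.
  apply: ler_pM n_p _; rewrite ?mulr_ge0 ?powR_ge0 ?exprn_ge0 ?ler0n //.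
  by apply: lerXn2r b_le; rewrite nnegrE ?powR_ge0 ?ler0n.
have q0 : 0 < q by rewrite powR_gt0.
have := gnp_hamilton_power hk (isT : (2 <= L)%N) m0 n_large degm b0 (le_trans n_e b_ge)
  n_br q0 p_large p1 x_le_q.
set P := gnp_prob _ _ => bound.
have P1 : P <= 1.
  have q01 : 0 <= p <= 1 by rewrite powR_ge0.
  rewrite /P gnp_prob_product_weight -[leRHS](sum_product_weight (gnp_fun (T := 'I_n) p)).
  apply: ler_sum => E _; apply: ler_piMr; first exact/product_weight_ge0/prob_fun_gnp.
  by rewrite lern1 leq_b1.
rewrite -/p -/P ger0_norm ?subr_ge0 //; apply: le_trans bound _.
have bR0 : 0 < b%:R :> R by rewrite ltr0n.
rewrite ler_pdivrMr // [eps * _]mulrC -ler_pdivrMr //.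
exact: le_trans n_eps b_ge.
Unshelve. all: by end_near.
Qed.
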